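(* Let $P$ be a path linkage with $k\ge2$ edges, all of positive length. Let $p,q\in M(P)$ be such that neither $\theta(p)$ nor $\theta(q)$ is a critical value of $\theta$. Let $\alpha:[0,1]\to[P]$ be continuous with $\alpha(0)=\theta(p)$ and $\alpha(1)=\theta(q)$. If $\alpha([0,1])\cap\nabla(P)\neq\emptyset$, then there exists a continuous $\tilde\alpha:[0,1]\to M(P)$ with $\tilde\alpha(0)=p$, $\tilde\alpha(1)=q$ and $\theta\circ\tilde\alpha=\alpha$.
   Context: A path linkage is a linkage $P=(G,l)$ where $G$ is a path graph with vertices $1,\dots,k+1$ and edges $\{i,i+1\}$, $l$ assigning lengths to edges; its terminal vertices are $s=1$, $t=k+1$. $C(P)=\{p:V\to\mathbb R^2:|p(u)-p(v)|=l(\{u,v\})\text{ for every edge}\}$, and $M(P)$ is the quotient of $C(P)$ (subspace topology from $\mathbb R^{2|V|}$) by the group of orientation preserving isometries of $\mathbb R^2$, with the quotient topology. $\theta:M(P)\to\mathbb R$, $\theta(p)=|p(s)-p(t)|$, and $[P]=\theta(M(P))$. A point $p\in M(P)$ is a critical point of $\theta$ if $\theta(p)=0$ or all points $p(v)$, $v\in V$, lie on a common affine line in $\mathbb R^2$; a critical value is the image under $\theta$ of a critical point. $\nabla(P)=\{x\in[P]:\theta^{-1}(x)\text{ is connected}\}$. *)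

(* Defs.v *)
From Stdlib Require Import Reals.
Open Scope R_scope.

(* A path linkage with k edges: vertices 1..k+1 are encoded by indices
   0..k (vertex v is index v-1); edge {i+1,i+2} (i < k) has length l i.
   Terminal vertices: s = index 0, t = index k.
   A placement is a map nat -> R*R; only indices 0..k are meaningful. *)
Definition point := (R * R)%type.
Definition placement := nat -> point.

Definition dist (a b : point) : R :=
  sqrt ((fst a - fst b)^2 + (snd a - snd b)^2).

Definition inC (k : nat) (l : nat -> R) (p : placement) : Prop :=
  forall i, (i < k)%nat -> dist (p i) (p (S i)) = l i.

Definition or_isom (c s u w : R) (x : point) : point :=
  (c * fst x - s * snd x + u, s * fst x + c * snd x + w).

(* p and q represent the same point of M(P) *)
Definition congr (k : nat) (p q : placement) : Prop :=
  exists c s u w, c^2 + s^2 = 1 /\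
    forall i, (i <= k)%nat -> q i = or_isom c s u w (p i).

Definition theta (k : nat) (p : placement) : R := dist (p O) (p k).

Definition collinear (k : nat) (p : placement) : Prop :=
  exists a b c, (a <> 0 \/ b <> 0) /\
    forall i, (i <= k)%nat -> a * fst (p i) + b * snd (p i) = c.

Definition critical_point (k : nat) (p : placement) : Prop :=
  theta k p = 0 \/ collinear k p.

Definition critical_value (k : nat) (l : nat -> R) (x : R) : Prop :=
  exists p, inC k l p /\ critical_point k p /\ theta k p = x.

Definition image_theta (k : nat) (l : nat -> R) (x : R) : Prop :=
  exists p, inC k l p /\ theta k p = x.

(* Subsets of M(P) are represented by saturated subsets of C(P). *)
Definition saturated (k : nat) (l : nat -> R) (U : placement -> Prop) : Prop :=
  forall p q, inC k l p -> congr k p q -> U p -> U q.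

Definition openC (k : nat) (l : nat -> R) (U : placement -> Prop) : Prop :=
  forall p, inC k l p -> U p ->
    exists eps, 0 < eps /\
      forall q, inC k l q ->
        (forall i, (i <= k)%nat ->
           Rabs (fst (q i) - fst (p i)) < eps /\
           Rabs (snd (q i) - snd (p i)) < eps) ->
        U q.

(* open subsets of M(P) (quotient topology) = saturated open subsets of C(P) *)
Definition openM (k : nat) (l : nat -> R) (U : placement -> Prop) : Prop :=
  saturated k l U /\ openC k l U.

Definition fiber_connected (k : nat) (l : nat -> R) (x : R) : Prop :=
  ~ (exists U V : placement -> Prop,
       openM k l U /\ openM k l V /\
       (forall p, inC k l p -> theta k p = x -> U p \/ V p) /\
       (forall p, inC k l p -> theta k p = x -> ~ (U p /\ V p)) /\
       (exists p, inC k l p /\ theta k p = x /\ U p) /\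
       (exists p, inC k l p /\ theta k p = x /\ V p)).

Definition nabla (k : nat) (l : nat -> R) (x : R) : Prop :=
  image_theta k l x /\ fiber_connected k l x.

Definition in01 (t : R) : Prop := 0 <= t <= 1.

Definition cont01 (f : R -> R) : Prop :=
  forall t, in01 t -> forall eps, 0 < eps ->
    exists delta, 0 < delta /\
      forall s, in01 s -> Rabs (s - t) < delta -> Rabs (f s - f t) < eps.

(* A map [0,1] -> M(P), given by representatives a t in C(P), is continuous
   for the quotient topology on M(P): preimages of open sets of M(P) are
   open in [0,1]. *)
Definition contM01 (k : nat) (l : nat -> R) (a : R -> placement) : Prop :=
  forall U, openM k l U ->
    forall t, in01 t -> U (a t) ->
      exists delta, 0 < delta /\
        forall s, in01 s -> Rabs (s - t) < delta -> U (a s).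

(* Main.v *)
Require Import Defs.
From Stdlib Require Import Reals Lra Lia Psatz Arith Classical ClassicalEpsilon FunctionalExtensionality.
From Coquelicot Require Compactness Hierarchy ElemFct.
Open Scope R_scope.
Set Bullet Behavior "Strict Subproofs".

(* A point of M(P) is a family of unit edge vectors u_i up to rotation, and theta is the norm of
   the sum of the l_i u_i.  Let a >= b be the two longest bars and r_j the others.  The sign of
   u_a x u_b cuts each fibre of theta into two closed sheets.  A sheet is connected: dropping the
   bars r_j one at a time, the remaining partial sum has to stay in an annulus of width at least
   2 r_j, which every circle of radius r_j meets in a connected arc.  Near a noncritical value,
   turning a single bar not parallel to the sum absorbs any small change of theta, so
   connectedness of a sheet turns into: a lift of alpha starting at p can reach, in arbitrarily
   short time, any section of theta lying in the sheet of p.  If the fibre over x = alpha(t0) is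
   connected, it contains a point with u_a parallel to u_b, and explicit linkages with three or
   fewer effective bars give sections of theta over [P], one in each sheet, that coincide over x.
   One follows the section of the sheet of p, changes to that of the sheet of q at time t0, and
   reaches q by the time reversal of the first step. *)

(** * Limits along a filter *)

(** As [alpha] is merely continuous, it may meet critical values at infinitely many times, and near
    such values theta need not have local lifts. Composing a section of theta with [alpha] lifts any
    [alpha] at once, so lifting by hand is confined to a short time next to each end, which is where
    noncriticality enters. The connected fibre is used only for its point with parallel a and b.
    There these bars act as one bar of length a + b or a - b, and a section of the shortened linkage
    has a and b parallel throughout, hence lies in both sheets; it is then extended over the rest of
    [P] separately in each sheet. The two longest bars are singled out because they close a residual
    vector exactly when its norm is in [a - b, a + b]: this interval has length 2b, every other bar
    is at most b, and the closing triangle of given orientation is unique unless the residual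
    vanishes. Connectedness is phrased by locally constant predicates, so that it applies directly
    to the predicate of being reachable in arbitrarily short time. *)

Definition filt {T} (F : (T -> Prop) -> Prop) : Prop :=
  F (fun _ => True) /\
  (forall P Q, F P -> F Q -> F (fun x => P x /\ Q x)) /\
  (forall P Q : T -> Prop, (forall x, P x -> Q x) -> F P -> F Q).

(** One calculus of limits serves times ([at_]) and configurations paired with a length ([nhds]). *)
Definition lim {T} (F : (T -> Prop) -> Prop) (f : T -> R) (v : R) : Prop :=
  forall e, 0 < e -> F (fun x => Rabs (f x - v) < e).

Lemma lim_const T F (c : R) : @filt T F -> lim F (fun _ => c) c.
Proof.
  intros (h1 & _ & h3) e he; eapply h3; [|exact h1].
  intros; simpl; replace (c - c) with 0 by ring; now rewrite Rabs_R0.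
Qed.

Lemma lim_comp T F (f : T -> R) g v :
  filt F -> continuity_pt g v -> lim F f v -> lim F (fun x => g (f x)) (g v).
Proof.
  intros (h1 & h2 & h3) hg hf e he.
  destruct (hg e he) as [d [hd h]].
  eapply h3; [|exact (hf d hd)]; intros x hx; cbv beta in *.
  destruct (Req_dec v (f x)) as [E|E].
  - rewrite E. replace (g (f x) - g (f x)) with 0 by ring; now rewrite Rabs_R0.
  - apply (h (f x)); split; [split; [exact I | exact E] | exact hx].
Qed.

Lemma lim_plus T F (f g : T -> R) a b :
  filt F -> lim F f a -> lim F g b -> lim F (fun x => f x + g x) (a + b).
Proof.
  intros (h1 & h2 & h3) hf hg e he.
  eapply h3; [|exact (h2 _ _ (hf (e/2) ltac:(lra)) (hg (e/2) ltac:(lra)))].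
  intros x [H1 H2]; cbv beta in *.
  replace (f x + g x - (a + b)) with ((f x - a) + (g x - b)) by ring.
  pose proof (Rabs_triang (f x - a) (g x - b)); lra.
Qed.

Lemma lim_mult T F (f g : T -> R) a b :
  filt F -> lim F f a -> lim F g b -> lim F (fun x => f x * g x) (a * b).
Proof.
  intros (h1 & h2 & h3) hf hg e he.
  set (M := Rabs a + Rabs b + 1).
  assert (hM : 1 <= M) by (unfold M; pose proof (Rabs_pos a); pose proof (Rabs_pos b); lra).
  set (d := Rmin 1 (e / (2 * M))).
  assert (hq : 0 < e / (2*M)) by (apply Rdiv_lt_0_compat; lra).
  assert (hd : 0 < d) by (apply Rmin_glb_lt; lra).
  assert (hd1 : d <= 1) by apply Rmin_l.
  assert (hd2 : d * (2 * M) <= e).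
  { apply Rle_trans with (e / (2*M) * (2*M)).
    - apply Rmult_le_compat_r; [lra | apply Rmin_r].
    - right; field; lra. }
  eapply h3; [|exact (h2 _ _ (hf d hd) (hg d hd))].
  intros x [H1 H2]; cbv beta in *.
  replace (f x * g x - a * b) with ((f x - a) * (g x - b) + a * (g x - b) + b * (f x - a)) by ring.
  eapply Rle_lt_trans; [apply Rabs_triang|].
  eapply Rle_lt_trans; [apply Rplus_le_compat_r, Rabs_triang|].
  rewrite !Rabs_mult.
  pose proof (Rabs_pos a); pose proof (Rabs_pos b).
  pose proof (Rabs_pos (f x - a)); pose proof (Rabs_pos (g x - b)).
  unfold M in hd2; nra.
Qed.

Lemma lim_opp T F (f : T -> R) a : filt F -> lim F f a -> lim F (fun x => - f x) (- a).
Proof.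
  intros hF hf e he. destruct hF as (h1 & h2 & h3).
  eapply h3; [|exact (hf e he)]; intros x hx; cbv beta in *.
  replace (- f x - - a) with (- (f x - a)) by ring; now rewrite Rabs_Ropp.
Qed.

Lemma lim_minus T F (f g : T -> R) a b :
  filt F -> lim F f a -> lim F g b -> lim F (fun x => f x - g x) (a - b).
Proof. intros; unfold Rminus; apply lim_plus; auto; now apply lim_opp. Qed.

Lemma lim_inv T F (f : T -> R) a : filt F -> a <> 0 -> lim F f a -> lim F (fun x => / f x) (/ a).
Proof.
  intros hF ha hf. apply (lim_comp T F f Rinv); auto.
  apply (continuity_pt_inv (fun x => x)); auto.
  apply derivable_continuous_pt, derivable_pt_id.
Qed.

Lemma lim_div T F (f g : T -> R) a b :
  filt F -> b <> 0 -> lim F f a -> lim F g b -> lim F (fun x => f x / g x) (a / b).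
Proof. intros; unfold Rdiv; apply lim_mult; auto; now apply lim_inv. Qed.

Lemma lim_pow2 T F (f : T -> R) a : filt F -> lim F f a -> lim F (fun x => f x ^ 2) (a ^ 2).
Proof.
  intros; simpl. apply lim_mult; auto. apply lim_mult; auto. now apply lim_const.
Qed.

Lemma lim_sqrt T F (f : T -> R) a : filt F -> lim F f a -> lim F (fun x => sqrt (f x)) (sqrt a).
Proof.
  intros hF hf. apply (lim_comp T F f sqrt); auto.
  apply Hierarchy.continuity_pt_filterlim, ElemFct.continuous_sqrt.
Qed.

Lemma Rmax_abs a b : Rmax a b = (a + b + Rabs (a - b)) / 2.
Proof. unfold Rmax, Rabs; destruct (Rle_dec a b), (Rcase_abs (a - b)); lra. Qed.

Lemma Rmin_abs a b : Rmin a b = (a + b - Rabs (a - b)) / 2.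
Proof. unfold Rmin, Rabs; destruct (Rle_dec a b), (Rcase_abs (a - b)); lra. Qed.

Lemma lim_abs T F (f : T -> R) a : filt F -> lim F f a -> lim F (fun x => Rabs (f x)) (Rabs a).
Proof. intros; apply (lim_comp T F f Rabs); auto; apply Rcontinuity_abs. Qed.

Lemma lim_ext T F (f g : T -> R) v :
  filt F -> (forall x, f x = g x) -> lim F f v -> lim F g v.
Proof.
  intros (h1&h2&h3) E hf e he; eapply h3; [|exact (hf e he)].
  intros x; cbv beta; now rewrite E.
Qed.

Lemma lim_max T F (f g : T -> R) a b :
  filt F -> lim F f a -> lim F g b -> lim F (fun x => Rmax (f x) (g x)) (Rmax a b).
Proof.
  intros. rewrite Rmax_abs.
  apply (lim_ext _ _ (fun x => (f x + g x + Rabs (f x - g x)) / 2)); auto.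
  { intros; now rewrite Rmax_abs. }
  apply lim_div; [auto|lra| |now apply lim_const].
  apply lim_plus; auto; [now apply lim_plus|]. apply lim_abs; auto; now apply lim_minus.
Qed.

Lemma lim_min T F (f g : T -> R) a b :
  filt F -> lim F f a -> lim F g b -> lim F (fun x => Rmin (f x) (g x)) (Rmin a b).
Proof.
  intros. rewrite Rmin_abs.
  apply (lim_ext _ _ (fun x => (f x + g x - Rabs (f x - g x)) / 2)); auto.
  { intros; now rewrite Rmin_abs. }
  apply lim_div; [auto|lra| |now apply lim_const].
  apply lim_minus; auto; [now apply lim_plus|]. apply lim_abs; auto; now apply lim_minus.
Qed.

Lemma lim_ev_gt T F (f : T -> R) a c : filt F -> lim F f a -> c < a -> F (fun x => c < f x).
Proof.
  intros (h1&h2&h3) hf h; eapply h3; [|exact (hf (a - c) ltac:(lra))].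
  intros x hx; cbv beta in *; apply Rabs_def2 in hx; lra.
Qed.

(* ~ F (~ P) means that P holds frequently along F. *)
Lemma lim_freq_le T F (f : T -> R) a c :
  filt F -> lim F f a -> ~ F (fun x => ~ f x <= c) -> a <= c.
Proof.
  intros hF hf h. destruct (Rle_or_lt a c) as [|H]; auto. exfalso; apply h.
  pose proof (lim_ev_gt _ _ _ _ _ hF hf H) as K. destruct hF as (h1&h2&h3).
  eapply h3; [|exact K]. intros x hx; cbv beta in *; lra.
Qed.

Lemma filt_forall_lt T (F : (T -> Prop) -> Prop) (P : nat -> T -> Prop) n :
  filt F -> (forall j, (j < n)%nat -> F (P j)) -> F (fun x => forall j, (j < n)%nat -> P j x).
Proof.
  intros (h1&h2&h3) h. induction n.
  - eapply h3; [|exact h1]. intros; lia.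
  - eapply h3; [|exact (h2 _ _ (IHn ltac:(intros; apply h; lia)) (h n ltac:(lia)))].
    intros x [H1 H2] j hj. destruct (Nat.eq_dec j n); [subst; auto|apply H1; lia].
Qed.

(** * Continuous functions of a real variable *)

Definition at_ (t : R) (P : R -> Prop) : Prop :=
  exists d, 0 < d /\ forall s, Rabs (s - t) < d -> P s.

Lemma filt_at t : filt (at_ t).
Proof.
  split; [exists 1; split; auto; lra|split].
  - intros P Q [d [hd H]] [d' [hd' H']]. exists (Rmin d d'); split.
    + now apply Rmin_glb_lt.
    + intros s hs; split; [apply H|apply H']; eapply Rlt_le_trans; eauto; [apply Rmin_l|apply Rmin_r].
  - intros P Q h [d [hd H]]; exists d; split; auto.
Qed.

Lemma lim_id t : lim (at_ t) (fun s => s) t.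
Proof. intros e he; exists e; split; auto. Qed.

Definition cont (f : R -> R) : Prop := forall t, lim (at_ t) f (f t).

Lemma lim_at_comp T F (f : T -> R) (g : R -> R) v w :
  filt F -> lim F f v -> lim (at_ v) g w -> lim F (fun x => g (f x)) w.
Proof.
  intros (h1&h2&h3) hf hg e he. destruct (hg e he) as [d [hd H]].
  eapply h3; [|exact (hf d hd)]. intros x hx; cbv beta in *; auto.
Qed.

Lemma cont_comp f g : cont f -> cont g -> cont (fun t => g (f t)).
Proof. intros hf hg t. apply (lim_at_comp _ _ f g (f t)); auto using filt_at. Qed.

(** Precomposition with [clamp] extends a function from a segment to the whole line, where
    continuity is stated with two-sided limits. *)
Definition clamp (a b t : R) := Rmax a (Rmin b t).

Lemma cont_clamp a b : cont (clamp a b).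
Proof.
  intros t; unfold clamp. apply lim_max; auto using filt_at, lim_const.
  apply lim_min; auto using filt_at, lim_const, lim_id.
Qed.

Lemma clamp_in a b t : a <= b -> a <= clamp a b t <= b.
Proof.
  intros; unfold clamp. split; [apply Rmax_l|]. apply Rmax_lub; auto. apply Rmin_l.
Qed.

Lemma clamp_id a b t : a <= t <= b -> clamp a b t = t.
Proof. intros; unfold clamp. rewrite Rmin_right by lra. apply Rmax_right; lra. Qed.

Lemma cont_clamped a b f : a <= b ->
  (forall t, a <= t <= b -> lim (at_ t) f (f t)) -> cont (fun t => f (clamp a b t)).
Proof.
  intros hab hf t. apply (lim_at_comp _ _ (clamp a b) f (clamp a b t)); auto using filt_at.
  - apply cont_clamp.
  - apply hf, clamp_in; auto.
Qed.

(** Take the supremum [m] of the times up to which [P] keeps its value at [a]: the neighbourhood of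
    [m] carries this value past [m] unless [m = b]. *)
Lemma locally_constant_segment (P : R -> Prop) a b : a <= b ->
  (forall t, a <= t <= b -> exists e, 0 < e /\
     forall s, a <= s <= b -> Rabs (s - t) < e -> (P t <-> P s)) ->
  (P a <-> P b).
Proof.
  intros hab hP.
  set (E := fun t => a <= t <= b /\ forall s, a <= s <= t -> (P a <-> P s)).
  assert (hE : E a).
  { split; [lra|]. intros s hs. replace s with a by lra. tauto. }
  destruct (completeness E) as [m [hub hlub]].
  - exists b; intros x [H _]; lra.
  - now exists a.
  - assert (ham : a <= m <= b).
    { split; [now apply hub|]. apply hlub; intros x [H _]; lra. }
    destruct (hP m ham) as [e [he H]].
    assert (exists t, E t /\ m - e < t).
    { apply NNPP; intros K. assert (m <= m - e); [|lra].
      apply hlub; intros x hx. destruct (Rle_or_lt x (m - e)); auto.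
      exfalso; apply K; now exists x. }
    destruct H0 as [t [[ht1 ht2] ht3]].
    assert (htm : t <= m) by (apply hub; now split).
    assert (Pm : P a <-> P m).
    { rewrite (H t) by (try split; try lra; apply Rabs_def1; lra).
      apply ht2; lra. }
    assert (F : E (Rmin b (m + e / 2))).
    { split; [split; [apply Rmin_glb; lra|apply Rmin_l]|].
      intros s [hs1 hs2]. destruct (Rle_or_lt s t) as [h|h]; [apply ht2; lra|].
      pose proof (Rmin_l b (m+e/2)); pose proof (Rmin_r b (m+e/2)).
      rewrite Pm. apply H; [lra|]. apply Rabs_def1; lra. }
    assert (Rmin b (m + e/2) <= m) by (now apply hub).
    assert (m = b).
    { revert H0; unfold Rmin; destruct (Rle_dec b (m + e/2)); lra. }
    now subst.
Qed.

Ltac lims := repeat first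
  [ assumption | apply filt_at | apply lim_const | apply lim_id | apply lim_minus | apply lim_plus
  | apply lim_div | apply lim_mult | apply lim_opp | apply lim_pow2 | apply lim_sqrt | apply lim_max | apply lim_min
  | apply lim_abs ].

(** * Unit edge vectors *)

(** Only the indices below the number [k] of bars matter; slot [k] later serves as a spare
    coordinate. *)
Definition cfg := nat -> R * R.

Fixpoint sm (f : nat -> R) (n : nat) : R :=
  match n with O => 0 | S n => sm f n + f n end.

(** Used on lengths as well: [upd l i 0] makes bar [i] weightless without renumbering the others. *)
Definition upd {T} (u : nat -> T) (n : nat) (v : T) : nat -> T :=
  fun j => if Nat.eqb j n then v else u j.

Definition sx (w : nat -> R) k (u : cfg) := sm (fun j => w j * fst (u j)) k.
Definition sy (w : nat -> R) k (u : cfg) := sm (fun j => w j * snd (u j)) k.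

Definition unitv (p : R * R) : Prop := fst p ^ 2 + snd p ^ 2 = 1.
Definition unitc k (u : cfg) : Prop := forall j, (j < k)%nat -> unitv (u j).

(** Squares keep the condition polynomial. The sign of [y] is left open; [theta_pl] restores it from
    [0 <= y]. *)
Definition over w k (u : cfg) (y : R) : Prop :=
  unitc k u /\ sx w k u ^ 2 + sy w k u ^ 2 = y ^ 2.

Definition cr (p q : R * R) : R := fst p * snd q - snd p * fst q.
Definition rotp (c s : R) (p : R * R) : R * R :=
  (c * fst p - s * snd p, s * fst p + c * snd p).
Definition rote k (u v : cfg) : Prop :=
  exists c s, c ^ 2 + s ^ 2 = 1 /\ forall j, (j < k)%nat -> v j = rotp c s (u j).

Definition near k (z m : cfg) (e : R) : Prop :=
  forall j, (j < k)%nat ->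
    Rabs (fst (m j) - fst (z j)) < e /\ Rabs (snd (m j) - snd (z j)) < e.

Lemma upd_eq T (u : nat -> T) n v : upd u n v n = v.
Proof. unfold upd; now rewrite Nat.eqb_refl. Qed.

Lemma upd_neq T (u : nat -> T) n v j : j <> n -> upd u n v j = u j.
Proof. intros h; unfold upd; now rewrite (proj2 (Nat.eqb_neq j n) h). Qed.

Lemma upd_same T (u : nat -> T) n : upd u n (u n) = u.
Proof.
  apply functional_extensionality; intros j; unfold upd.
  destruct (Nat.eqb_spec j n); now subst.
Qed.

Lemma sm_ext f g n : (forall j, (j < n)%nat -> f j = g j) -> sm f n = sm g n.
Proof. induction n; intros h; simpl; auto. rewrite IHn, h; auto. Qed.

Lemma sm_plus f g n : sm (fun j => f j + g j) n = sm f n + sm g n.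
Proof. induction n; simpl; [ring|rewrite IHn; ring]. Qed.

Lemma sm_scal c f n : sm (fun j => c * f j) n = c * sm f n.
Proof. induction n; simpl; [ring|rewrite IHn; ring]. Qed.

Lemma sm_le f g n : (forall j, (j < n)%nat -> f j <= g j) -> sm f n <= sm g n.
Proof.
  induction n; intros h; simpl; [lra|].
  pose proof (IHn ltac:(auto)). pose proof (h n ltac:(lia)). lra.
Qed.

Lemma sm_ge0 f n : (forall j, (j < n)%nat -> 0 <= f j) -> 0 <= sm f n.
Proof.
  induction n; intros h; simpl; [lra|].
  pose proof (IHn ltac:(auto)). pose proof (h n ltac:(lia)). lra.
Qed.

Lemma sm_upd f n i v : (i < n)%nat -> sm (upd f i v) n = sm f n - f i + v.
Proof.
  induction n; intros h; [lia|]. simpl. destruct (Nat.eq_dec i n) as [->|E].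
  - rewrite upd_eq. rewrite (sm_ext (upd f n v) f n); [ring|].
    intros; apply upd_neq; lia.
  - rewrite IHn by lia. rewrite (upd_neq _ f i v n) by lia. ring.
Qed.

Lemma sm_term_le f n i : (forall j, (j < n)%nat -> 0 <= f j) -> (i < n)%nat -> f i <= sm f n.
Proof.
  intros h hi. pose proof (sm_upd f n i 0 hi).
  assert (0 <= sm (upd f i 0) n); [|lra].
  apply sm_ge0; intros j hj; unfold upd; destruct (Nat.eqb j i); [lra|auto].
Qed.

Lemma lim_sm T F (f : nat -> T -> R) (v : nat -> R) n :
  filt F -> (forall j, (j < n)%nat -> lim F (f j) (v j)) ->
  lim F (fun x => sm (fun j => f j x) n) (sm v n).
Proof.
  intros hF. induction n; intros h; simpl; [now apply lim_const|].
  apply lim_plus; auto.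
Qed.

Lemma lim_sx T F (X : T -> cfg) u w k : filt F ->
  (forall j, (j < k)%nat -> lim F (fun x => fst (X x j)) (fst (u j))) ->
  lim F (fun x => sx w k (X x)) (sx w k u).
Proof. intros hF h; unfold sx; apply lim_sm; auto. intros; lims; auto. Qed.

Lemma lim_sy T F (X : T -> cfg) u w k : filt F ->
  (forall j, (j < k)%nat -> lim F (fun x => snd (X x j)) (snd (u j))) ->
  lim F (fun x => sy w k (X x)) (sy w k u).
Proof. intros hF h; unfold sy; apply lim_sm; auto. intros; lims; auto. Qed.

Lemma sx_upd l k u i v : (i < k)%nat ->
  sx l k (upd u i v) = sx (upd l i 0) k u + l i * fst v.
Proof.
  intros hi; unfold sx.
  rewrite (sm_ext _ (upd (fun j => l j * fst (u j)) i (l i * fst v)) k).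
  2:{ intros j hj; unfold upd; destruct (Nat.eqb_spec j i); now subst. }
  rewrite (sm_ext (fun j => upd l i 0 j * fst (u j)) (upd (fun j => l j * fst (u j)) i 0) k).
  2:{ intros j hj; unfold upd; destruct (Nat.eqb_spec j i); subst; ring. }
  rewrite !sm_upd by auto. ring.
Qed.

Lemma sy_upd l k u i v : (i < k)%nat ->
  sy l k (upd u i v) = sy (upd l i 0) k u + l i * snd v.
Proof.
  intros hi; unfold sy.
  rewrite (sm_ext _ (upd (fun j => l j * snd (u j)) i (l i * snd v)) k).
  2:{ intros j hj; unfold upd; destruct (Nat.eqb_spec j i); now subst. }
  rewrite (sm_ext (fun j => upd l i 0 j * snd (u j)) (upd (fun j => l j * snd (u j)) i 0) k).
  2:{ intros j hj; unfold upd; destruct (Nat.eqb_spec j i); subst; ring. }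
  rewrite !sm_upd by auto. ring.
Qed.

Lemma sx_split l k u i : (i < k)%nat -> sx l k u = sx (upd l i 0) k u + l i * fst (u i).
Proof. intros; rewrite <- sx_upd by auto. now rewrite upd_same. Qed.

Lemma sy_split l k u i : (i < k)%nat -> sy l k u = sy (upd l i 0) k u + l i * snd (u i).
Proof. intros; rewrite <- sy_upd by auto. now rewrite upd_same. Qed.

Lemma unitv_bound p : unitv p -> -1 <= fst p <= 1 /\ -1 <= snd p <= 1.
Proof. unfold unitv; intros h; split; nra. Qed.

Lemma unitv_rotp c s p : c ^ 2 + s ^ 2 = 1 -> unitv p -> unitv (rotp c s p).
Proof.
  unfold unitv, rotp; cbn [fst snd]; intros h h'.
  replace ((c * fst p - s * snd p) ^ 2 + (s * fst p + c * snd p) ^ 2)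
    with ((c^2+s^2) * (fst p ^2 + snd p ^2)) by ring. rewrite h, h'; ring.
Qed.

Lemma cr_rotp c s p q : c ^ 2 + s ^ 2 = 1 -> cr (rotp c s p) (rotp c s q) = cr p q.
Proof.
  intros h; unfold cr, rotp; cbn [fst snd].
  transitivity ((c^2+s^2) * (fst p * snd q - snd p * fst q)); [ring|rewrite h; ring].
Qed.

Lemma rote_refl k u : rote k u u.
Proof.
  exists 1, 0; split; [ring|]. intros j hj; unfold rotp.
  destruct (u j); simpl; f_equal; ring.
Qed.

Lemma rote_eq k u v : (forall j, (j < k)%nat -> v j = u j) -> rote k u v.
Proof.
  intros h; exists 1, 0; split; [ring|]. intros j hj; unfold rotp.
  rewrite h by auto. destruct (u j); simpl; f_equal; ring.
Qed.

Lemma rote_sym k u v : rote k u v -> rote k v u.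
Proof.
  intros (c & s & h & H). exists c, (-s); split; [rewrite <- h; ring|].
  intros j hj; rewrite H by auto. unfold rotp; destruct (u j) as [a b]; cbn [fst snd].
  f_equal; [transitivity ((c^2+s^2)*a)|transitivity ((c^2+s^2)*b)];
    try ring; rewrite h; ring.
Qed.

Lemma rote_trans k u v w : rote k u v -> rote k v w -> rote k u w.
Proof.
  intros (c & s & h & H) (c' & s' & h' & H').
  exists (c' * c - s' * s), (s' * c + c' * s); split.
  - transitivity ((c'^2+s'^2)*(c^2+s^2)); [ring|rewrite h, h'; ring].
  - intros j hj. rewrite H', H by auto. unfold rotp; simpl; f_equal; ring.
Qed.

Lemma rote_cr k u v i j : (i < k)%nat -> (j < k)%nat -> rote k u v -> cr (v i) (v j) = cr (u i) (u j).
Proof. intros hi hj (c & s & h & H). rewrite !H by auto. now apply cr_rotp. Qed.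

Lemma sx_rotp w k u v c s : (forall j, (j < k)%nat -> v j = rotp c s (u j)) ->
  sx w k v = c * sx w k u - s * sy w k u.
Proof.
  intros H; unfold sx, sy. rewrite <- !sm_scal.
  replace (sm (fun j => c * (w j * fst (u j))) k - sm (fun j => s * (w j * snd (u j))) k)
    with (sm (fun j => c * (w j * fst (u j))) k + (-1) * sm (fun j => s * (w j * snd (u j))) k) by ring.
  rewrite <- sm_scal, <- sm_plus. apply sm_ext; intros j hj; rewrite H by auto; simpl; ring.
Qed.

Lemma sy_rotp w k u v c s : (forall j, (j < k)%nat -> v j = rotp c s (u j)) ->
  sy w k v = s * sx w k u + c * sy w k u.
Proof.
  intros H; unfold sx, sy. rewrite <- !sm_scal.
  rewrite <- sm_plus. apply sm_ext; intros j hj; rewrite H by auto; simpl; ring.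
Qed.

Lemma over_rote w k u v y : rote k u v -> over w k u y -> over w k v y.
Proof.
  intros (c & s & h & H) [h1 h2]; split.
  - intros j hj; rewrite H by auto; now apply unitv_rotp, h1.
  - rewrite (sx_rotp w k u v c s H), (sy_rotp w k u v c s H), <- h2.
    transitivity ((c^2+s^2) * (sx w k u ^2 + sy w k u ^2)); [ring|rewrite h; ring].
Qed.

Lemma near_sub k z m e e' : e <= e' -> near k z m e -> near k z m e'.
Proof. intros h H j hj; destruct (H j hj); lra. Qed.

Lemma near_refl k z e : 0 < e -> near k z z e.
Proof.
  intros he j hj; split.
  - replace (fst (z j) - fst (z j)) with 0 by ring; now rewrite Rabs_R0.
  - replace (snd (z j) - snd (z j)) with 0 by ring; now rewrite Rabs_R0.
Qed.

Lemma near_trans k z m n a b : near k z m a -> near k m n b -> near k z n (a + b).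
Proof.
  intros H H' j hj; destruct (H j hj) as [h1 h2], (H' j hj) as [h3 h4]; split.
  - replace (fst (n j) - fst (z j)) with ((fst (n j) - fst (m j)) + (fst (m j) - fst (z j))) by ring.
    eapply Rle_lt_trans; [apply Rabs_triang|lra].
  - replace (snd (n j) - snd (z j)) with ((snd (n j) - snd (m j)) + (snd (m j) - snd (z j))) by ring.
    eapply Rle_lt_trans; [apply Rabs_triang|lra].
Qed.

(** * Lifted paths *)

(** For [al] the identity this is a section of theta over [[lo, hi]]. Continuity is asked on the
    whole line and only the length condition on the segment, so that restriction and composition
    with [al] are immediate. *)
Definition pth l k (al : R -> R) (lo hi : R) (X : R -> cfg) : Prop :=
  (forall j, (j < k)%nat -> cont (fun t => fst (X t j)) /\ cont (fun t => snd (X t j))) /\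
  (forall t, lo <= t <= hi -> over l k (X t) (al t)).

Definition lift l k al t1 u1 t2 u2 : Prop :=
  exists X, pth l k al t1 t2 X /\ rote k u1 (X t1) /\ rote k u2 (X t2).

Lemma pth_glue l k al lo mid hi X Y :
  lo <= mid <= hi -> pth l k al lo mid X -> pth l k al mid hi Y -> rote k (Y mid) (X mid) ->
  exists Z, pth l k al lo hi Z /\
    (forall t, lo <= t <= mid -> rote k (X t) (Z t)) /\
    (forall t, mid <= t <= hi -> rote k (Y t) (Z t)).
Proof.
  intros hm [cX oX] [cY oY] (c & s & hcs & H).
  (* After the constant rotation of [Y] both paths agree at [mid]. Freezing each beyond [mid],
     adding, and subtracting the common value glues them by a single formula whose continuity needs
     no case distinction. *)
  set (Z := fun t j =>
    (fst (X (Rmin t mid) j) + fst (rotp c s (Y (Rmax t mid) j)) - fst (X mid j),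
     snd (X (Rmin t mid) j) + snd (rotp c s (Y (Rmax t mid) j)) - snd (X mid j))).
  assert (ZX : forall t, t <= mid -> rote k (X t) (Z t)).
  { intros t ht; apply rote_eq; intros j hj; unfold Z.
    rewrite Rmin_left, Rmax_right, <- H by auto. destruct (X t j), (X mid j); simpl; f_equal; ring. }
  assert (ZY : forall t, mid <= t -> rote k (Y t) (Z t)).
  { intros t ht; exists c, s; split; auto. intros j hj; unfold Z.
    rewrite Rmin_right, Rmax_left by auto.
    set (q := rotp c s (Y t j)). destruct (X mid j), q; simpl; f_equal; ring. }
  exists Z; split; [split|split].
  - intros j hj. destruct (cX j hj) as [c1 c2], (cY j hj) as [c3 c4].
    assert (cmin : cont (fun t => Rmin t mid)) by (intros t; lims).
    assert (cmax : cont (fun t => Rmax t mid)) by (intros t; lims).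
    pose proof (cont_comp _ _ cmin c1); pose proof (cont_comp _ _ cmin c2).
    pose proof (cont_comp _ _ cmax c3); pose proof (cont_comp _ _ cmax c4).
    cbv beta in *.
    split; intros t; unfold Z, rotp; simpl; lims; auto.
  - intros t ht. destruct (Rle_or_lt t mid).
    + eapply over_rote; [apply ZX; auto|apply oX; lra].
    + eapply over_rote; [apply ZY; lra|apply oY; lra].
  - intros; apply ZX; lra.
  - intros; apply ZY; lra.
Qed.

Lemma lift_trans l k al t1 t2 t3 u1 u2 u3 : t1 <= t2 <= t3 ->
  lift l k al t1 u1 t2 u2 -> lift l k al t2 u2 t3 u3 -> lift l k al t1 u1 t3 u3.
Proof.
  intros ht (X & pX & X1 & X2) (Y & pY & Y1 & Y2).
  destruct (pth_glue l k al t1 t2 t3 X Y) as (Z & pZ & ZX & ZY); auto.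
  - eapply rote_trans; [apply rote_sym; exact Y1|exact X2].
  - exists Z; split; auto; split.
    + eapply rote_trans; [exact X1|apply ZX; lra].
    + eapply rote_trans; [exact Y2|apply ZY; lra].
Qed.

Lemma lift_reverse l k al t1 u1 t2 u2 :
  lift l k (fun t => al (1 - t)) t1 u1 t2 u2 -> lift l k al (1 - t2) u2 (1 - t1) u1.
Proof.
  intros (X & [cX oX] & X1 & X2). exists (fun t => X (1 - t)); split; [split|].
  - intros j hj; destruct (cX j hj) as [c1 c2].
    assert (c0 : cont (fun t => 1 - t)) by (intros t; lims).
    split; [exact (cont_comp _ _ c0 c1)|exact (cont_comp _ _ c0 c2)].
  - intros t ht. replace (al t) with (al (1 - (1 - t))) by (f_equal; ring).
    apply oX; lra.
  - replace (1 - (1 - t2)) with t2 by ring; replace (1 - (1 - t1)) with t1 by ring; auto.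
Qed.

Lemma pth_compose l k al lo hi t1 t2 X :
  cont al -> (forall t, t1 <= t <= t2 -> lo <= al t <= hi) ->
  pth l k (fun y => y) lo hi X -> pth l k al t1 t2 (fun t => X (al t)).
Proof.
  intros hal hr [cX oX]; split.
  - intros j hj; destruct (cX j hj) as [c1 c2].
    split; [exact (cont_comp _ _ hal c1)|exact (cont_comp _ _ hal c2)].
  - intros t ht; apply oX; auto.
Qed.

(** * Closing a triangle *)

(* The unit vector u with |v + L u| = y for which the sign of v x u is that of kappa. *)
Definition solv (ka L vx vy y : R) : R * R :=
  let n := vx ^ 2 + vy ^ 2 in
  let c := (y ^ 2 - n - L ^ 2) / (2 * L) in
  let s := sqrt (n - c ^ 2) in
  ((c * vx - ka * s * vy) / n, (c * vy + ka * s * vx) / n).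

(** Expanding |v + L u| = y forces v.u = c, and Lagrange's identity then gives (v x u)^2 = n - c^2,
    so the last hypothesis is the triangle inequality. *)
Lemma solv_ok ka L vx vy y : ka ^ 2 = 1 -> 0 < L -> 0 < vx ^ 2 + vy ^ 2 ->
  ((y ^ 2 - (vx ^ 2 + vy ^ 2) - L ^ 2) / (2 * L)) ^ 2 <= vx ^ 2 + vy ^ 2 ->
  unitv (solv ka L vx vy y) /\
  (vx + L * fst (solv ka L vx vy y)) ^ 2 + (vy + L * snd (solv ka L vx vy y)) ^ 2 = y ^ 2 /\
  0 <= ka * cr (vx, vy) (solv ka L vx vy y).
Proof.
  intros hk hL hn hc. unfold solv, unitv, cr; cbn [fst snd].
  set (n := vx ^ 2 + vy ^ 2) in *. set (c := (y ^ 2 - n - L ^ 2) / (2 * L)) in *.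
  set (s := sqrt (n - c ^ 2)).
  assert (hs : s * s = n - c ^ 2) by (apply sqrt_sqrt; lra).
  assert (hs0 : 0 <= s) by apply sqrt_pos.
  assert (hy : y ^ 2 = n + 2 * L * c + L ^ 2) by (unfold c; field; lra).
  set (gx := (c * vx - ka * s * vy) / n). set (gy := (c * vy + ka * s * vx) / n).
  assert (hu : gx ^ 2 + gy ^ 2 = 1).
  { transitivity ((c ^ 2 + ka ^ 2 * (s * s)) * n / (n * n)).
    - unfold gx, gy, n; field; fold n; lra.
    - rewrite hk, hs; field; lra. }
  assert (hd : vx * gx + vy * gy = c).
  { transitivity (c * (vx ^ 2 + vy ^ 2) / n); [unfold gx, gy; field; lra|fold n; field; lra]. }
  split; [exact hu|split].
  - rewrite hy. transitivity (n + 2 * L * (vx * gx + vy * gy) + L ^ 2 * (gx ^ 2 + gy ^ 2)).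
    + unfold n; ring.
    + rewrite hu, hd; ring.
  - replace (ka * (vx * gy - vy * gx)) with s; auto.
    transitivity (ka ^ 2 * s * (vx ^ 2 + vy ^ 2) / n); [|unfold gx, gy; field; lra].
    fold n; rewrite hk; field; lra.
Qed.

(** The inequality on the orientation includes zero: a degenerate triangle is the solution for both
    signs [ka], which is how sections of different sheets can meet. *)
Lemma solv_uniq ka L vx vy y u : ka ^ 2 = 1 -> 0 < L -> 0 < vx ^ 2 + vy ^ 2 -> unitv u ->
  (vx + L * fst u) ^ 2 + (vy + L * snd u) ^ 2 = y ^ 2 -> 0 <= ka * cr (vx, vy) u ->
  solv ka L vx vy y = u.
Proof.
  intros hk hL hn hu hy hc. unfold solv.
  set (n := vx ^ 2 + vy ^ 2) in *. destruct u as [a b]; unfold unitv, cr in *; cbn [fst snd] in *.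
  assert (hcc : (y ^ 2 - n - L ^ 2) / (2 * L) = vx * a + vy * b).
  { rewrite <- hy. transitivity ((2 * L * (vx * a + vy * b) + L ^ 2 * (a ^ 2 + b ^ 2 - 1)) / (2 * L)).
    - unfold n; field; lra.
    - rewrite hu; field; lra. }
  rewrite hcc.
  assert (hs : sqrt (n - (vx * a + vy * b) ^ 2) = ka * (vx * b - vy * a)).
  { rewrite <- (sqrt_pow2 (ka * (vx * b - vy * a))) by auto. f_equal.
    replace ((ka * (vx * b - vy * a)) ^ 2) with (ka ^ 2 * (vx * b - vy * a) ^ 2) by ring.
    rewrite hk. replace n with (n * (a ^ 2 + b ^ 2)) by (rewrite hu; ring). unfold n; ring. }
  rewrite hs. f_equal.
  - transitivity (((vx * a + vy * b) * vx - ka ^ 2 * (vx * b - vy * a) * vy) / n); [field; lra|].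
    rewrite hk. transitivity (a * (vx ^ 2 + vy ^ 2) / n); [field; lra|fold n; field; lra].
  - transitivity (((vx * a + vy * b) * vy + ka ^ 2 * (vx * b - vy * a) * vx) / n); [field; lra|].
    rewrite hk. transitivity (b * (vx ^ 2 + vy ^ 2) / n); [field; lra|fold n; field; lra].
Qed.

(** Degenerate triangles need no exception, as [sqrt] is continuous on the whole line, being 0 on
    negative numbers. *)
Lemma lim_solv T F ka L (vx vy y : T -> R) a b z : filt F -> L <> 0 -> a ^ 2 + b ^ 2 <> 0 ->
  lim F vx a -> lim F vy b -> lim F y z ->
  lim F (fun t => fst (solv ka L (vx t) (vy t) (y t))) (fst (solv ka L a b z)) /\
  lim F (fun t => snd (solv ka L (vx t) (vy t) (y t))) (snd (solv ka L a b z)).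
Proof.
  intros hF hL hn h1 h2 h3; unfold solv; cbn [fst snd]; split; lims; intros E; apply hL; lra.
Qed.

(** * Local lifting at a noncritical point *)

(** The nearby [m] need not consist of unit vectors, because the straight interpolation in
    [local_lift] leaves the circle; configuration and length vary independently. *)
Definition nhds k (z : cfg) (x : R) (P : cfg * R -> Prop) : Prop :=
  exists e, 0 < e /\ forall m y, near k z m e -> Rabs (y - x) < e -> P (m, y).

Lemma filt_nhds k z x : filt (nhds k z x).
Proof.
  split; [exists 1; split; auto; lra|split].
  - intros P Q [d [hd H]] [d' [hd' H']]. exists (Rmin d d'); split; [now apply Rmin_glb_lt|].
    pose proof (Rmin_l d d'); pose proof (Rmin_r d d').
    intros m y hm hy; split; [apply H|apply H']; try lra; eapply near_sub; eauto.
  - intros P Q h [d [hd H]]; exists d; split; auto.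
Qed.

Lemma lim_nhds_fst k z x j : (j < k)%nat -> lim (nhds k z x) (fun q => fst (fst q j)) (fst (z j)).
Proof. intros hj e he; exists e; split; auto; intros m y hm hy; simpl; apply hm; auto. Qed.

Lemma lim_nhds_snd k z x j : (j < k)%nat -> lim (nhds k z x) (fun q => snd (fst q j)) (snd (z j)).
Proof. intros hj e he; exists e; split; auto; intros m y hm hy; simpl; apply hm; auto. Qed.

Lemma lim_nhds_val k z x : lim (nhds k z x) (fun q => snd q) x.
Proof. intros e he; exists e; split; auto. Qed.

Definition nrm (p : R * R) : R * R :=
  (fst p / sqrt (fst p ^ 2 + snd p ^ 2), snd p / sqrt (fst p ^ 2 + snd p ^ 2)).

Lemma nrm_unit p : unitv p -> nrm p = p.
Proof.
  unfold unitv, nrm; intros ->. rewrite sqrt_1. destruct p; simpl; f_equal; field.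
Qed.

Lemma unitv_nrm p : 0 < fst p ^ 2 + snd p ^ 2 -> unitv (nrm p).
Proof.
  intros h; unfold unitv, nrm; cbn [fst snd].
  set (n := fst p ^ 2 + snd p ^ 2) in *.
  assert (hs : sqrt n * sqrt n = n) by (apply sqrt_sqrt; lra).
  assert (0 < sqrt n) by (now apply sqrt_lt_R0).
  transitivity (n / (sqrt n * sqrt n)); [unfold n; field; fold n; lra|rewrite hs; field; lra].
Qed.

Lemma lim_nrm T F (f g : T -> R) a b : filt F -> 0 < a ^ 2 + b ^ 2 -> lim F f a -> lim F g b ->
  lim F (fun x => fst (nrm (f x, g x))) (fst (nrm (a, b))) /\
  lim F (fun x => snd (nrm (f x, g x))) (snd (nrm (a, b))).
Proof.
  intros hF h h1 h2. assert (sqrt (a ^ 2 + b ^ 2) <> 0) by (apply Rgt_not_eq, sqrt_lt_R0; auto).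
  unfold nrm; cbn [fst snd]; split; lims.
Qed.

Lemma sign_exists r : r <> 0 -> exists ka, ka ^ 2 = 1 /\ 0 < ka * r.
Proof.
  intros h; destruct (Rlt_or_le 0 r); [exists 1|exists (-1)]; split; try ring; lra.
Qed.

Definition resx l i k (m : cfg) := sx (upd l i 0) k (fun j => nrm (m j)).
Definition resy l i k (m : cfg) := sy (upd l i 0) k (fun j => nrm (m j)).

Lemma sx_nrm w k u : unitc k u -> sx w k (fun j => nrm (u j)) = sx w k u.
Proof. intros h; apply sm_ext; intros; now rewrite nrm_unit by auto. Qed.

Lemma sy_nrm w k u : unitc k u -> sy w k (fun j => nrm (u j)) = sy w k u.
Proof. intros h; apply sm_ext; intros; now rewrite nrm_unit by auto. Qed.

(* Everything outside edge i is prescribed; the length of edge i and the value y determine its direction. *)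
Definition refit ka l i k (m : cfg) (y : R) : cfg :=
  upd (fun j => nrm (m j)) i (solv ka (l i) (resx l i k m) (resy l i k m) y).

(** The first three clauses make [refit] land over [y]; the orientation clause makes it the identity
    on configurations already over [y]. *)
Definition refit_good ka l i k (m : cfg) (y : R) : Prop :=
  (forall j, (j < k)%nat -> 0 < fst (m j) ^ 2 + snd (m j) ^ 2) /\
  0 < resx l i k m ^ 2 + resy l i k m ^ 2 /\
  ((y ^ 2 - (resx l i k m ^ 2 + resy l i k m ^ 2) - l i ^ 2) / (2 * l i)) ^ 2
     <= resx l i k m ^ 2 + resy l i k m ^ 2 /\
  0 <= ka * cr (resx l i k m, resy l i k m) (m i).

Lemma refit_over ka l i k m y : ka ^ 2 = 1 -> 0 < l i -> (i < k)%nat ->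
  refit_good ka l i k m y -> over l k (refit ka l i k m y) y.
Proof.
  intros hk hl hi (h1 & h2 & h3 & h4).
  destruct (solv_ok ka (l i) _ _ y hk hl h2 h3) as (h5 & h6 & _). split.
  - intros j hj; unfold refit, upd. destruct (Nat.eqb_spec j i); auto.
    apply unitv_nrm; auto.
  - unfold refit; rewrite sx_upd, sy_upd by auto. exact h6.
Qed.

Lemma refit_id ka l i k m y : ka ^ 2 = 1 -> 0 < l i -> (i < k)%nat ->
  refit_good ka l i k m y -> over l k m y ->
  forall j, (j < k)%nat -> refit ka l i k m y j = m j.
Proof.
  intros hk hl hi (h1 & h2 & h3 & h4) [u o] j hj; unfold refit, upd.
  destruct (Nat.eqb_spec j i) as [->|]; [|now apply nrm_unit, u].
  apply solv_uniq; auto. unfold resx, resy. rewrite sx_nrm, sy_nrm by auto.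
  rewrite <- sx_split, <- sy_split; auto.
Qed.

Lemma lim_res T F (X : T -> cfg) u l i k : filt F ->
  (forall j, (j < k)%nat -> 0 < fst (u j) ^ 2 + snd (u j) ^ 2) ->
  (forall j, (j < k)%nat -> lim F (fun x => fst (X x j)) (fst (u j)) /\
                            lim F (fun x => snd (X x j)) (snd (u j))) ->
  lim F (fun x => resx l i k (X x)) (resx l i k u) /\
  lim F (fun x => resy l i k (X x)) (resy l i k u).
Proof.
  intros hF hp hX; unfold resx, resy; split.
  - apply (lim_sx _ _ (fun x j => nrm (X x j)) (fun j => nrm (u j))); auto. intros j hj.
    destruct (hX j hj) as [h1 h2]. pose proof (proj1 (lim_nrm _ _ _ _ _ _ hF (hp j hj) h1 h2)) as K.
    eapply lim_ext; [auto| |]; [|rewrite (surjective_pairing (u j)); exact K].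
    intros x; cbv beta; now rewrite <- surjective_pairing.
  - apply (lim_sy _ _ (fun x j => nrm (X x j)) (fun j => nrm (u j))); auto. intros j hj.
    destruct (hX j hj) as [h1 h2]. pose proof (proj2 (lim_nrm _ _ _ _ _ _ hF (hp j hj) h1 h2)) as K.
    eapply lim_ext; [auto| |]; [|rewrite (surjective_pairing (u j)); exact K].
    intros x; cbv beta; now rewrite <- surjective_pairing.
Qed.

Lemma lim_refit T F (X : T -> cfg) (y : T -> R) u v ka l i k : filt F -> 0 < l i ->
  refit_good ka l i k u v -> lim F y v ->
  (forall j, (j < k)%nat -> lim F (fun x => fst (X x j)) (fst (u j)) /\
                            lim F (fun x => snd (X x j)) (snd (u j))) ->
  forall j, (j < k)%nat ->
    lim F (fun x => fst (refit ka l i k (X x) (y x) j)) (fst (refit ka l i k u v j)) /\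
    lim F (fun x => snd (refit ka l i k (X x) (y x) j)) (snd (refit ka l i k u v j)).
Proof.
  intros hF hl (h1 & h2 & h3 & h4) hy hX j hj. unfold refit, upd.
  destruct (Nat.eqb_spec j i) as [->|].
  - destruct (lim_res T F X u l i k hF h1 hX). apply lim_solv; auto; lra.
  - destruct (hX j hj) as [h5 h6]. pose proof (lim_nrm _ _ _ _ _ _ hF (h1 j hj) h5 h6) as [K1 K2].
    split; (eapply lim_ext; [auto| |]); [|rewrite (surjective_pairing (u j)); exact K1|
      |rewrite (surjective_pairing (u j)); exact K2];
    intros x; cbv beta; now rewrite <- surjective_pairing.
Qed.

(** With v the sum of the other bars, v x u_i equals the cross product of the whole sum with u_i,
    hence is nonzero. So |v|^2 > (v.u_i)^2: the triangle is nondegenerate, all conditions are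
    strict, and they persist nearby. *)
Lemma refit_nbhd l i k z x : (forall j, (j < k)%nat -> 0 < l j) -> (i < k)%nat ->
  over l k z x -> cr (sx l k z, sy l k z) (z i) <> 0 ->
  exists ka, ka ^ 2 = 1 /\ nhds k z x (fun q => refit_good ka l i k (fst q) (snd q)).
Proof.
  intros hl hi [hu ho] hc. destruct (sign_exists _ hc) as (ka & hk & hkc).
  exists ka; split; auto.
  assert (hF := filt_nhds k z x).
  pose proof (hl i hi) as hli.
  assert (hp : forall j, (j < k)%nat -> 0 < fst (z j) ^ 2 + snd (z j) ^ 2).
  { intros j hj; rewrite (hu j hj); lra. }
  destruct (lim_res _ _ (fun q : cfg * R => fst q) z l i k hF hp) as [Lx Ly].
  { intros j hj; split; [now apply lim_nhds_fst|now apply lim_nhds_snd]. }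
  assert (Ex : resx l i k z = sx l k z - l i * fst (z i)).
  { unfold resx; rewrite sx_nrm, (sx_split l k z i) by auto; ring. }
  assert (Ey : resy l i k z = sy l k z - l i * snd (z i)).
  { unfold resy; rewrite sy_nrm, (sy_split l k z i) by auto; ring. }
  assert (hcv : cr (resx l i k z, resy l i k z) (z i) = cr (sx l k z, sy l k z) (z i)).
  { unfold cr; cbn [fst snd]; rewrite Ex, Ey; ring. }
  set (C := cr (sx l k z, sy l k z) (z i)) in *.
  pose proof (hu i hi) as hui; unfold unitv in hui.
  set (vx := resx l i k z) in *; set (vy := resy l i k z) in *.
  assert (hC : C ^ 2 = vx ^ 2 + vy ^ 2 - (vx * fst (z i) + vy * snd (z i)) ^ 2).
  { rewrite <- hcv; unfold cr; cbn [fst snd].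
    transitivity ((vx ^ 2 + vy ^ 2) * (fst (z i) ^ 2 + snd (z i) ^ 2) - (vx * fst (z i) + vy * snd (z i)) ^ 2);
      [ring|rewrite hui; ring]. }
  assert (hC0 : 0 < C ^ 2) by nra.
  assert (hn : 0 < vx ^ 2 + vy ^ 2) by (pose proof (pow2_ge_0 (vx * fst (z i) + vy * snd (z i))); lra).
  assert (hd : (x ^ 2 - (vx ^ 2 + vy ^ 2) - l i ^ 2) / (2 * l i) = vx * fst (z i) + vy * snd (z i)).
  { rewrite <- ho. replace (sx l k z) with (vx + l i * fst (z i)) by (rewrite Ex; ring).
    replace (sy l k z) with (vy + l i * snd (z i)) by (rewrite Ey; ring).
    transitivity ((2 * l i * (vx * fst (z i) + vy * snd (z i)) +
      l i ^ 2 * (fst (z i) ^ 2 + snd (z i) ^ 2 - 1)) / (2 * l i)); [field; lra|rewrite hui; field; lra]. }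
  assert (L1 : nhds k z x (fun q => forall j, (j < k)%nat -> 0 < fst (fst q j) ^ 2 + snd (fst q j) ^ 2)).
  { apply (filt_forall_lt _ _ (fun j (q : cfg * R) => 0 < fst (fst q j) ^ 2 + snd (fst q j) ^ 2)); auto.
    intros j hj. apply (lim_ev_gt _ _ _ (fst (z j) ^ 2 + snd (z j) ^ 2)); auto.
    pose proof (lim_nhds_fst k z x j hj); pose proof (lim_nhds_snd k z x j hj). lims. }
  assert (L2 := lim_nhds_val k z x).
  assert (Mx := lim_nhds_fst k z x i hi). assert (My := lim_nhds_snd k z x i hi).
  assert (L3 : nhds k z x (fun q => 0 < resx l i k (fst q) ^ 2 + resy l i k (fst q) ^ 2)).
  { apply (lim_ev_gt _ _ _ (vx ^ 2 + vy ^ 2)); auto. lims. }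
  assert (L4 : nhds k z x (fun q => 0 < resx l i k (fst q) ^ 2 + resy l i k (fst q) ^ 2 -
    ((snd q ^ 2 - (resx l i k (fst q) ^ 2 + resy l i k (fst q) ^ 2) - l i ^ 2) / (2 * l i)) ^ 2)).
  { apply (lim_ev_gt _ _ _ (vx ^ 2 + vy ^ 2 - ((x ^ 2 - (vx ^ 2 + vy ^ 2) - l i ^ 2) / (2 * l i)) ^ 2)); auto.
    - lims; lra.
    - rewrite hd; lra. }
  assert (L5 : nhds k z x (fun q => 0 < ka * cr (resx l i k (fst q), resy l i k (fst q)) (fst q i))).
  { apply (lim_ev_gt _ _ _ (ka * cr (vx, vy) (z i))); auto.
    - unfold cr; cbn [fst snd]; lims.
    - rewrite hcv; auto. }
  destruct hF as (f1 & f2 & f3).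
  eapply f3; [|exact (f2 _ _ L1 (f2 _ _ L3 (f2 _ _ L4 L5)))].
  intros q (q1 & q2 & q3 & q4); cbv beta in *. split; [auto|split; [auto|split; lra]].
Qed.

Lemma convex_lt s a b e : 0 <= s <= 1 -> a < e -> b < e -> (1 - s) * a + s * b < e.
Proof. intros hs ha hb. destruct (Rle_or_lt s (1/2)); nra. Qed.

Lemma convex_abs_lt s a b z e : 0 <= s <= 1 -> Rabs (a - z) < e -> Rabs (b - z) < e ->
  Rabs ((1 - s) * a + s * b - z) < e.
Proof.
  intros hs ha hb; apply Rabs_def2 in ha; apply Rabs_def2 in hb.
  pose proof (convex_lt s (a - z) (b - z) e hs ltac:(lra) ltac:(lra)).
  pose proof (convex_lt s (z - a) (z - b) e hs ltac:(lra) ltac:(lra)).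
  apply Rabs_def1; lra.
Qed.

Lemma convex_near k z m1 m2 e s : 0 <= s <= 1 -> near k z m1 e -> near k z m2 e ->
  near k z (fun j => ((1 - s) * fst (m1 j) + s * fst (m2 j), (1 - s) * snd (m1 j) + s * snd (m2 j))) e.
Proof.
  intros hs h1 h2 j hj; cbn [fst snd]. destruct (h1 j hj) as [a1 a2], (h2 j hj) as [b1 b2].
  split; now apply convex_abs_lt.
Qed.

(** Interpolate linearly between [m1] and [m2] and let bar [i] absorb the error through [refit]. At
    both ends the length is already right, so [refit] changes nothing there. *)
Lemma local_lift l i k z x : (forall j, (j < k)%nat -> 0 < l j) -> (i < k)%nat ->
  over l k z x -> cr (sx l k z, sy l k z) (z i) <> 0 ->
  exists e, 0 < e /\ forall al t1 t2 m1 m2, cont al -> t1 < t2 ->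
    (forall t, t1 <= t <= t2 -> Rabs (al t - x) < e) ->
    near k z m1 e -> near k z m2 e -> over l k m1 (al t1) -> over l k m2 (al t2) ->
    lift l k al t1 m1 t2 m2.
Proof.
  intros hl hi ho hc. destruct (refit_nbhd l i k z x hl hi ho hc) as (ka & hk & e & he & H).
  cbn [fst snd] in H.
  exists e; split; auto. intros al t1 t2 m1 m2 hal ht hnear n1 n2 o1 o2.
  pose proof (hl i hi) as hli.
  set (s := fun t => (t - t1) / (t2 - t1)).
  set (q := fun t j => ((1 - s t) * fst (m1 j) + s t * fst (m2 j), (1 - s t) * snd (m1 j) + s t * snd (m2 j)) : R * R).
  assert (hs : forall t, t1 <= t <= t2 -> 0 <= s t <= 1).
  { intros t h; unfold s; split.
    - apply Rmult_le_pos; [lra|]. left; apply Rinv_0_lt_compat; lra.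
    - apply Rmult_le_reg_r with (t2 - t1); [lra|]. unfold Rdiv; rewrite Rmult_assoc, Rinv_l; lra. }
  assert (hg : forall t, t1 <= t <= t2 -> refit_good ka l i k (q t) (al t)).
  { intros t h; apply H; auto. apply convex_near; auto. }
  assert (E : forall t m, t1 <= t <= t2 -> (forall j, q t j = m j) -> over l k m (al t) ->
     rote k m (refit ka l i k (q t) (al t))).
  { intros t m h Em om. apply rote_eq; intros j hj.
    assert (q t = m) by (apply functional_extensionality; auto).
    rewrite refit_id; auto; now rewrite H0. }
  exists (fun t => refit ka l i k (q (clamp t1 t2 t)) (al (clamp t1 t2 t))); split; [split|split].
  - intros j hj.
    assert (K : forall t, t1 <= t <= t2 ->
      lim (at_ t) (fun t => fst (refit ka l i k (q t) (al t) j)) (fst (refit ka l i k (q t) (al t) j)) /\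
      lim (at_ t) (fun t => snd (refit ka l i k (q t) (al t) j)) (snd (refit ka l i k (q t) (al t) j))).
    { intros t h. apply lim_refit; auto using filt_at.
      intros j' hj'; unfold q, s; cbn [fst snd]; split; lims; lra. }
    split; [apply (cont_clamped t1 t2 (fun t => fst (refit ka l i k (q t) (al t) j)))|
            apply (cont_clamped t1 t2 (fun t => snd (refit ka l i k (q t) (al t) j)))];
      try lra; intros t h; apply K; auto.
  - intros t h. rewrite clamp_id by auto. apply refit_over; auto.
  - rewrite clamp_id by lra. apply E; auto; [lra|]. intros j; unfold q, s.
    replace ((t1 - t1) / (t2 - t1)) with 0 by (field; lra). destruct (m1 j); cbn [fst snd]; f_equal; ring.
  - rewrite clamp_id by lra. apply E; auto; [lra|]. intros j; unfold q, s.
    replace ((t2 - t1) / (t2 - t1)) with 1 by (field; lra). destruct (m2 j); cbn [fst snd]; f_equal; ring.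
Qed.

(** Theta is open at a transverse configuration: refit [z] itself to the length [y]; the result
    depends continuously on [y] and is [z] for [y = x]. *)
Lemma local_surj l i k z x : (forall j, (j < k)%nat -> 0 < l j) -> (i < k)%nat ->
  over l k z x -> cr (sx l k z, sy l k z) (z i) <> 0 ->
  forall e, 0 < e -> exists d, 0 < d /\
    forall y, Rabs (y - x) < d -> exists m, near k z m e /\ over l k m y.
Proof.
  intros hl hi ho hc e he. destruct (refit_nbhd l i k z x hl hi ho hc) as (ka & hk & e0 & he0 & H).
  cbn [fst snd] in H. pose proof (hl i hi) as hli.
  assert (hg : forall y, Rabs (y - x) < e0 -> refit_good ka l i k z y).
  { intros y hy; apply H; auto. now apply near_refl. }
  assert (hgx : refit_good ka l i k z x).
  { apply hg. replace (x - x) with 0 by ring; now rewrite Rabs_R0. }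
  assert (K : at_ x (fun y => near k z (refit ka l i k z y) e)).
  { apply (filt_forall_lt _ _ (fun j y => Rabs (fst (refit ka l i k z y j) - fst (z j)) < e /\
       Rabs (snd (refit ka l i k z y j) - snd (z j)) < e)); auto using filt_at.
    intros j hj.
    destruct (lim_refit _ (at_ x) (fun _ => z) (fun y => y) z x ka l i k (filt_at x) hli hgx (lim_id x)) with j
      as [K1 K2]; auto.
    { intros; split; lims. }
    rewrite refit_id in K1, K2 by auto.
    apply (proj1 (proj2 (filt_at x))); [apply K1|apply K2]; auto. }
  destruct K as (d & hd & K).
  exists (Rmin d e0); split; [now apply Rmin_glb_lt|]. intros y hy.
  exists (refit ka l i k z y); split.
  - apply K. eapply Rlt_le_trans; [exact hy|apply Rmin_l].
  - apply refit_over; auto. apply hg. eapply Rlt_le_trans; [exact hy|apply Rmin_r].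
Qed.

(** * Configurations reached in arbitrarily short time *)

(** As [near n] sees only the first [n] coordinates, such a predicate is also blind, on [D], to all
    later ones. *)
Definition locally_constant n (D Q : cfg -> Prop) : Prop :=
  forall u, D u -> exists e, 0 < e /\
    forall u', D u' -> near n u u' e -> (Q u <-> Q u').

(** Up to sign and the factor [l i], this cross product is the derivative of half the squared length
    when bar [i] turns. *)
Definition transverse l k (z : cfg) : Prop :=
  exists i, (i < k)%nat /\ cr (sx l k z, sy l k z) (z i) <> 0.

Definition quick l k al (p z : cfg) : Prop :=
  exists e, 0 < e /\ forall m t, near k z m e -> 0 < t < e -> over l k m (al t) ->
    lift l k al 0 p t m.

Lemma quick_self l k al p : (forall j, (j < k)%nat -> 0 < l j) -> cont al ->
  over l k p (al 0) -> transverse l k p -> quick l k al p p.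
Proof.
  intros hl hal ho (i & hi & hc).
  destruct (local_lift l i k p (al 0) hl hi ho hc) as (e & he & H).
  destruct (hal 0 e he) as (d & hd & Hd).
  exists (Rmin d e); split; [now apply Rmin_glb_lt|].
  pose proof (Rmin_l d e); pose proof (Rmin_r d e).
  intros m t hm ht om. apply H; auto; try lra.
  - intros s hs; apply Hd; apply Rabs_def1; lra.
  - now apply near_refl.
  - eapply near_sub; eauto.
Qed.

(** Openness of [quick] is built in. For its negation, suppose a point [z'] close to [z] is quick:
    go from [p] to some [m'] near [z'], supplied by [local_surj], and from there to any target near
    [z] by the local lift around [z]. Then [z] is quick too. *)
Lemma quick_locally_constant l k al p : (forall j, (j < k)%nat -> 0 < l j) -> cont al ->
  (forall z, over l k z (al 0) -> transverse l k z) ->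
  locally_constant k (fun z => over l k z (al 0)) (quick l k al p).
Proof.
  intros hl hal htr z oz. destruct (htr z oz) as (i & hi & hc).
  destruct (local_lift l i k z (al 0) hl hi oz hc) as (e & he & H).
  destruct (classic (quick l k al p z)) as [qz|nqz].
  - destruct qz as (e1 & he1 & H1). exists (e1 / 2); split; [lra|].
    intros z' oz' nz; split; [intros _|intros _; now exists e1].
    exists (e1 / 2); split; [lra|]. intros m t hm ht om. apply H1; auto; try lra.
    replace e1 with (e1 / 2 + e1 / 2) by lra. eapply near_trans; eauto.
  - exists (e / 2); split; [lra|]. intros z' oz' nz; split; [tauto|]. intros qz'; exfalso; apply nqz.
    destruct qz' as (e1 & he1 & H1). destruct (htr z' oz') as (i' & hi' & hc').
    destruct (local_surj l i' k z' (al 0) hl hi' oz' hc' (Rmin e1 (e/2))) as (d & hd & Hd).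
    { apply Rmin_glb_lt; lra. }
    destruct (hal 0 (Rmin d e) ltac:(now apply Rmin_glb_lt)) as (r & hr & Hr).
    exists (Rmin r e); split; [now apply Rmin_glb_lt|].
    pose proof (Rmin_l r e); pose proof (Rmin_r r e).
    pose proof (Rmin_l d e); pose proof (Rmin_r d e).
    pose proof (Rmin_l e1 (e/2)); pose proof (Rmin_r e1 (e/2)).
    intros m t hm ht om.
    (* At most [t / 2], to leave time for the second leg; at most [e1 / 2], to stay in the time
       window in which [z'] is quick. *)
    set (t' := Rmin (t / 2) (e1 / 2)).
    assert (ht' : 0 < t') by (apply Rmin_glb_lt; lra).
    assert (t' <= t / 2) by apply Rmin_l. assert (t' <= e1 / 2) by apply Rmin_r.
    assert (B : forall s, 0 <= s <= t -> Rabs (al s - al 0) < Rmin d e).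
    { intros s hs; apply Hr; apply Rabs_def1; lra. }
    destruct (Hd (al t')) as (m' & hm' & om').
    { eapply Rlt_le_trans; [apply B; lra|lra]. }
    apply lift_trans with t' m'; [lra| |].
    + apply H1; auto; [|lra]. eapply near_sub; eauto.
    + apply H; auto; try lra.
      * intros s hs; eapply Rlt_le_trans; [apply B; lra|lra].
      * replace e with (e / 2 + e / 2) by lra. eapply near_trans; eauto. eapply near_sub; eauto.
      * now apply near_sub with (Rmin r e).
Qed.

(** * Connectedness of the sheets of a fibre *)

Definition connected_cfg n (D : cfg -> Prop) : Prop :=
  forall Q, locally_constant n D Q -> forall u u', D u -> D u' -> Q u -> Q u'.

Definition adherent n (D : cfg -> Prop) (u : cfg) : Prop :=
  forall e, 0 < e -> exists u', near n u u' e /\ D u'.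

(** Closed conditions pass to adherent points. The length coordinate of [nhds] is a dummy held at
    0. *)
Lemma adherent_le n D u f a c : lim (nhds n u 0) (fun q => f (fst q)) a ->
  adherent n D u -> (forall u', D u' -> f u' <= c) -> a <= c.
Proof.
  intros hf had hD. apply (lim_freq_le _ _ _ _ _ (filt_nhds n u 0) hf).
  intros (e & he & H). destruct (had e he) as (u' & hn & hu').
  apply (H u' 0 hn); [|now apply hD]. replace (0 - 0) with 0 by ring; now rewrite Rabs_R0.
Qed.

Lemma adherent_eq n D u f a c : lim (nhds n u 0) (fun q => f (fst q)) a ->
  adherent n D u -> (forall u', D u' -> f u' = c) -> a = c.
Proof.
  intros hf had hD. apply Rle_antisym.
  - apply (adherent_le n D u f a c); auto. intros; rewrite hD; auto; lra.
  - assert (- a <= - c); [|lra].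
    apply (adherent_le n D u (fun u => - f u) (- a) (- c)); auto.
    + apply lim_opp; auto using filt_nhds.
    + intros; rewrite hD; auto; lra.
Qed.

Lemma adherent_unitc n m D u : (m <= n)%nat -> adherent n D u ->
  (forall u', D u' -> unitc m u') -> unitc m u.
Proof.
  intros hm had hD j hj. unfold unitv.
  apply (adherent_eq n D u (fun u => fst (u j) ^ 2 + snd (u j) ^ 2)); auto.
  - pose proof (lim_nhds_fst n u 0 j ltac:(lia)); pose proof (lim_nhds_snd n u 0 j ltac:(lia)).
    pose proof (filt_nhds n u 0). lims.
  - intros u' h; exact (hD u' h j hj).
Qed.

Lemma near_upd n u u' v v' e : near n u u' e ->
  Rabs (fst v' - fst v) < e /\ Rabs (snd v' - snd v) < e ->
  near (S n) (upd u n v) (upd u' n v') e.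
Proof.
  intros h h' j hj; unfold upd. destruct (Nat.eqb_spec j n); auto. apply h; lia.
Qed.

Lemma near_upd_last n u u' v d : near n u u' d ->
  Rabs (fst (u' n) - fst v) < d -> Rabs (snd (u' n) - snd v) < d ->
  near (S n) (upd u n v) u' d.
Proof.
  intros h h1 h2. rewrite <- (upd_same _ u' n). apply near_upd; auto.
Qed.

(* A closed map with connected fibres onto a connected base has a connected total space;
   closedness of the projection comes from the compactness of the last coordinate. *)
Lemma connected_cfg_fibration n (D B : cfg -> Prop) :
  (forall u, D u -> B u) ->
  (forall u, B u -> exists v, D (upd u n v)) ->
  (forall u, D u -> unitv (u n)) ->
  (forall u, adherent (S n) D u -> D u) ->
  (forall Q, locally_constant (S n) D Q -> forall u v v',
     D (upd u n v) -> D (upd u n v') -> Q (upd u n v) -> Q (upd u n v')) ->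
  connected_cfg n B -> connected_cfg (S n) D.
Proof.
  intros DB BD Du Dcl Dfib conB Q hQ.
  (* By [Dfib] some point of a fibre satisfies [Q] as soon as all do and conversely, so [Q] descends
     to the base. *)
  set (Q' := fun u => exists v, D (upd u n v) /\ Q (upd u n v)).
  assert (hQ' : locally_constant n B Q').
  { intros u bu.
    (* A radius for each last coordinate: from local constancy if the point is in [D], otherwise
       from closedness, which leaves no point of [D] within that radius. *)
    assert (P : forall vx vy, exists d : posreal, forall u',
      near (S n) (upd u n (vx, vy)) u' d -> D u' ->
      D (upd u n (vx, vy)) /\ (Q (upd u n (vx, vy)) <-> Q u')).
    { intros vx vy. destruct (classic (D (upd u n (vx, vy)))) as [h|h].
      - destruct (hQ _ h) as (e & he & H). exists (mkposreal e he). intros u' h1 h2; split; auto.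
      - apply NNPP; intros K. apply h, Dcl. intros e he. apply NNPP; intros K'.
        apply K. exists (mkposreal e he). intros u' h1 h2. exfalso; apply K'; now exists u'. }
    set (delta := fun vx vy => proj1_sig (constructive_indefinite_description _ (P vx vy))).
    assert (hdelta : forall vx vy u', near (S n) (upd u n (vx, vy)) u' (delta vx vy) -> D u' ->
      D (upd u n (vx, vy)) /\ (Q (upd u n (vx, vy)) <-> Q u')).
    { intros vx vy; unfold delta.
      exact (proj2_sig (constructive_indefinite_description _ (P vx vy))). }
    (* The unit circle lies in this square, so one radius [d] serves all last coordinates. *)
    destruct (Compactness.compactness_value_2d (-1) 1 (-1) 1 delta) as (d & hd).
    assert (key : forall u', near n u u' d -> D u' ->
      exists v, D (upd u n v) /\ (Q (upd u n v) <-> Q u')).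
    { intros u' hn hu'. pose proof (unitv_bound _ (Du u' hu')) as [a1 a2].
      destruct (classic (exists v, D (upd u n v) /\ (Q (upd u n v) <-> Q u'))) as [|K]; auto.
      exfalso. apply (hd (fst (u' n)) (snd (u' n))); try lra.
      intros (vx & vy & _ & _ & h1 & h2 & h3). apply K. exists (vx, vy).
      apply hdelta; auto. apply near_upd_last; auto. eapply near_sub; [exact h3|auto]. }
    assert (key' : forall u' v', near n u u' d -> D (upd u' n v') ->
      exists v, D (upd u n v) /\ (Q (upd u n v) <-> Q (upd u' n v'))).
    { intros u' v' hn. apply key. intros j hj. rewrite upd_neq by lia; apply hn; auto. }
    exists d; split; [apply cond_pos|]. intros u' bu' hn; split.
    - intros (v & h1 & h2). destruct (BD u' bu') as (v' & hv').
      exists v'; split; auto. destruct (key' u' v' hn hv') as (w & hw & E).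
      apply E. eapply Dfib; [exact hQ|exact h1|exact hw|exact h2].
    - intros (v' & h1 & h2). destruct (key' u' v' hn h1) as (w & hw & E).
      exists w; split; auto. now apply E. }
  intros u u' du du' qu.
  assert (q : Q' u') by (apply (conB Q' hQ' u); auto; exists (u n); rewrite upd_same; auto).
  destruct q as (v & h1 & h2).
  rewrite <- (upd_same _ u' n). eapply Dfib; [exact hQ|exact h1|rewrite upd_same; auto|exact h2].
Qed.

(** * Arcs, annuli and the closing triangle *)

Definition dot (p q : R * R) : R := fst p * fst q + snd p * snd q.

Lemma polar a b : exists h n, 0 <= h /\ unitv n /\ a = h * fst n /\ b = h * snd n.
Proof.
  destruct (Req_dec (a ^ 2 + b ^ 2) 0) as [E|E].
  - exists 0, (1, 0); unfold unitv; simpl. repeat split; try lra; nra.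
  - assert (hp : 0 < a ^ 2 + b ^ 2) by nra.
    exists (sqrt (a ^ 2 + b ^ 2)), (nrm (a, b)).
    assert (0 < sqrt (a ^ 2 + b ^ 2)) by (now apply sqrt_lt_R0).
    repeat split; [lra|now apply unitv_nrm| |]; unfold nrm; cbn [fst snd]; field; lra.
Qed.

Lemma dot_bound p q : unitv p -> unitv q -> -1 <= dot p q <= 1.
Proof.
  unfold unitv, dot; destruct p as [a b], q as [c d]; cbn [fst snd]; intros h h'.
  assert ((a * c + b * d) ^ 2 + (a * d - b * c) ^ 2 = 1) by
    (transitivity ((a^2+b^2)*(c^2+d^2)); [ring|rewrite h, h'; ring]).
  pose proof (pow2_ge_0 (a * d - b * c)). set (t := a * c + b * d) in *. split; nra.
Qed.

(** Move [v] to [nh] along the shorter arc, parametrised by the inner product with [nh], which grows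
    from [dot nh v] to 1; no angles are needed. *)
Lemma arc_constant n D Q u nh v : unitv nh -> unitv v -> locally_constant (S n) D Q ->
  (forall v', unitv v' -> dot nh v <= dot nh v' -> D (upd u n v')) ->
  (Q (upd u n v) <-> Q (upd u n nh)).
Proof.
  intros hn hv hQ hD.
  set (c0 := dot nh v).
  assert (hc0 := dot_bound nh v hn hv). fold c0 in hc0.
  (* [sg] records on which side of [nh] the vector [v] lies. *)
  assert (hx : exists sg, sg ^ 2 = 1 /\ 0 <= sg * cr nh v).
  { destruct (Rle_or_lt 0 (cr nh v)); [exists 1|exists (-1)]; split; try ring; lra. }
  destruct hx as (sg & hsg & hcr).
  set (path := fun c => (c * fst nh - sg * sqrt (1 - c ^ 2) * snd nh,
                         c * snd nh + sg * sqrt (1 - c ^ 2) * fst nh)).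
  unfold unitv in hn.
  assert (hpath : forall c, c0 <= c <= 1 -> unitv (path c) /\ dot nh (path c) = c).
  { intros c hc. unfold unitv, dot, path; cbn [fst snd].
    assert (hs : sqrt (1 - c ^ 2) * sqrt (1 - c ^ 2) = 1 - c ^ 2) by (apply sqrt_sqrt; nra).
    split.
    - transitivity ((c ^ 2 + sg ^ 2 * (sqrt (1 - c ^ 2) * sqrt (1 - c ^ 2))) * (fst nh ^ 2 + snd nh ^ 2)).
      + ring.
      + rewrite hs, hsg, hn; ring.
    - transitivity (c * (fst nh ^ 2 + snd nh ^ 2)); [ring|rewrite hn; ring]. }
  assert (E0 : path c0 = v).
  { assert (hs : sqrt (1 - c0 ^ 2) = sg * cr nh v).
    { rewrite <- (sqrt_pow2 (sg * cr nh v)) by auto. f_equal.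
      replace ((sg * cr nh v) ^ 2) with (sg ^ 2 * cr nh v ^ 2) by ring. rewrite hsg.
      replace 1 with ((fst nh ^ 2 + snd nh ^ 2) * (fst v ^ 2 + snd v ^ 2)) at 1
        by (rewrite hn, hv; ring).
      unfold c0, dot, cr; ring. }
    apply injective_projections; unfold path; cbn [fst snd]; rewrite hs.
    - transitivity (c0 * fst nh - sg ^ 2 * cr nh v * snd nh); [ring|].
      transitivity ((fst nh ^ 2 + snd nh ^ 2) * fst v); [|rewrite hn; ring].
      rewrite hsg; unfold c0, dot, cr; ring.
    - transitivity (c0 * snd nh + sg ^ 2 * cr nh v * fst nh); [ring|].
      transitivity ((fst nh ^ 2 + snd nh ^ 2) * snd v); [|rewrite hn; ring].
      rewrite hsg; unfold c0, dot, cr; ring. }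
  assert (E1 : path 1 = nh).
  { unfold path. replace (1 - 1 ^ 2) with 0 by ring. rewrite sqrt_0.
    apply injective_projections; cbn [fst snd]; ring. }
  rewrite <- E0, <- E1.
  apply (locally_constant_segment (fun c => Q (upd u n (path c)))); [lra|].
  intros c hc. destruct (hpath c hc) as [p1 p2].
  destruct (hQ (upd u n (path c))) as (e & he & H).
  { apply hD; auto. rewrite p2; unfold c0 in hc; lra. }
  assert (l1 : lim (at_ c) (fun c => fst (path c)) (fst (path c))) by (unfold path; cbn [fst snd]; lims).
  assert (l2 : lim (at_ c) (fun c => snd (path c)) (snd (path c))) by (unfold path; cbn [fst snd]; lims).
  destruct (proj1 (proj2 (filt_at c)) _ _ (l1 e he) (l2 e he)) as (d & hd & K).
  exists d; split; auto. intros s hs hsc. destruct (hpath s hs) as [q1 q2]. apply H.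
  - apply hD; auto. rewrite q2; unfold c0 in hs; lra.
  - apply near_upd; [now apply near_refl|]. now apply K.
Qed.

Definition resid (r : nat -> R) x n (u : cfg) : R * R := (x - sx r n u, - sy r n u).

(** Pinning the end of the linkage at [(x, 0)] uses up the rotations; the bounds concern the vector
    still to be covered by the remaining bars. *)
Definition annulus r x n rho tau (u : cfg) : Prop :=
  unitc n u /\ rho ^ 2 <= dot (resid r x n u) (resid r x n u) <= tau ^ 2.

Lemma sx_upd_out r n m u v : (n <= m)%nat -> sx r n (upd u m v) = sx r n u.
Proof. intros h; apply sm_ext; intros; rewrite upd_neq; auto; lia. Qed.

Lemma sy_upd_out r n m u v : (n <= m)%nat -> sy r n (upd u m v) = sy r n u.
Proof. intros h; apply sm_ext; intros; rewrite upd_neq; auto; lia. Qed.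

Lemma resid_upd_out r x n m u v : (n <= m)%nat -> resid r x n (upd u m v) = resid r x n u.
Proof. intros h; unfold resid; now rewrite sx_upd_out, sy_upd_out. Qed.

Lemma resid_S r x n u : resid r x (S n) u =
  (fst (resid r x n u) - r n * fst (u n), snd (resid r x n u) - r n * snd (u n)).
Proof. unfold resid, sx, sy; simpl; f_equal; ring. Qed.

(** The law of cosines. *)
Lemma dist2_polar y h nh v r : unitv nh -> unitv v -> fst y = h * fst nh -> snd y = h * snd nh ->
  dot (fst y - r * fst v, snd y - r * snd v) (fst y - r * fst v, snd y - r * snd v)
  = h ^ 2 + r ^ 2 - 2 * r * h * dot nh v.
Proof.
  unfold dot, unitv; cbn [fst snd]; intros hn hv -> ->.
  transitivity (h ^ 2 * (fst nh ^ 2 + snd nh ^ 2) + r ^ 2 * (fst v ^ 2 + snd v ^ 2)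
    - 2 * r * h * (fst nh * fst v + snd nh * snd v)); [ring|rewrite hn, hv; ring].
Qed.

Lemma unitc_upd n u v : unitc n u -> unitv v -> unitc (S n) (upd u n v).
Proof.
  intros h hv j hj; unfold upd; destruct (Nat.eqb_spec j n); auto. apply h; lia.
Qed.

Lemma unitc_le n m u : (n <= m)%nat -> unitc m u -> unitc n u.
Proof. intros h H j hj; apply H; lia. Qed.

Lemma lim_resid r x k u n : (n <= k)%nat ->
  lim (nhds k u 0) (fun q => fst (resid r x n (fst q))) (fst (resid r x n u)) /\
  lim (nhds k u 0) (fun q => snd (resid r x n (fst q))) (snd (resid r x n u)).
Proof.
  intros h. assert (hF := filt_nhds k u 0).
  unfold resid; cbn [fst snd]; split; lims.
  - apply lim_sx; auto. intros; apply lim_nhds_fst; lia.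
  - apply lim_sy; auto. intros; apply lim_nhds_snd; lia.
Qed.

Lemma adherent_annulus r x n rho tau u : adherent n (annulus r x n rho tau) u ->
  annulus r x n rho tau u.
Proof.
  intros had. assert (hF := filt_nhds n u 0).
  destruct (lim_resid r x n u n (le_n n)) as [l1 l2].
  split; [|split].
  - apply (adherent_unitc n n (annulus r x n rho tau)); auto. intros u' h; apply h.
  - assert (- dot (resid r x n u) (resid r x n u) <= - rho ^ 2); [|lra].
    apply (adherent_le n (annulus r x n rho tau) u (fun u => - dot (resid r x n u) (resid r x n u))); auto.
    + unfold dot; lims.
    + intros u' h; destruct h as (_ & h1 & h2); lra.
  - apply (adherent_le n (annulus r x n rho tau) u (fun u => dot (resid r x n u) (resid r x n u))); auto.
    + unfold dot; lims.
    + intros u' h; destruct h as (_ & h1 & h2); lra.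
Qed.

Lemma unitv_opp p : unitv p -> unitv (- fst p, - snd p).
Proof. unfold unitv; cbn [fst snd]; intros; lra. Qed.

(* The width condition tau - rho >= 2 r makes every circle of radius r meet the annulus in a connected arc. *)
Lemma arc_type h r rho tau : 0 <= h -> 0 <= r -> 0 <= rho -> 2 * r <= tau - rho ->
  rho ^ 2 <= (h - r) ^ 2 \/ (h + r) ^ 2 <= tau ^ 2.
Proof.
  intros. destruct (Rle_or_lt (h + r) tau); [right; nra|left].
  destruct (Rle_or_lt r h); nra.
Qed.

(** Forget bar [n]. By the law of cosines its direction is constrained only through the inner
    product with the direction [nh] of the residual, and one of the two bounds holds on the whole
    circle, so the fibre is an arc that contracts to its centre. *)
Lemma annulus_step r x n rho tau : 0 <= rho -> 0 <= r n -> 2 * r n <= tau - rho ->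
  connected_cfg n (annulus r x n (Rmax 0 (rho - r n)) (tau + r n)) ->
  connected_cfg (S n) (annulus r x (S n) rho tau).
Proof.
  intros hrho hr hw. set (rn := r n) in *.
  assert (hmax : 0 <= Rmax 0 (rho - rn) /\ rho - rn <= Rmax 0 (rho - rn)) by
    (split; [apply Rmax_l|apply Rmax_r]).
  apply connected_cfg_fibration.
  - intros u (h1 & h2 & h3). split; [eapply unitc_le; [|exact h1]; lia|].
    destruct (polar (fst (resid r x n u)) (snd (resid r x n u))) as (h & nh & hh & hn & e1 & e2).
    rewrite resid_S in h2, h3.
    rewrite (dist2_polar _ h nh) in h2, h3 by (auto; apply h1; lia). fold rn in h2, h3.
    pose proof (dot_bound nh (u n) hn (h1 n ltac:(lia))) as hd.
    set (c := dot nh (u n)) in *.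
    assert (E : dot (resid r x n u) (resid r x n u) = h ^ 2).
    { unfold dot; rewrite e1, e2. unfold unitv in hn.
      transitivity (h ^ 2 * (fst nh ^ 2 + snd nh ^ 2)); [ring|rewrite hn; ring]. }
    rewrite E. assert (0 <= rn * h) by nra.
    assert (h - rn <= tau) by (assert ((h - rn) ^ 2 <= tau ^ 2) by nra; nra).
    assert (rho <= h + rn) by (assert (rho ^ 2 <= (h + rn) ^ 2) by nra; nra).
    split; [|nra]. unfold Rmax in *. destruct (Rle_dec 0 (rho - rn)); nra.
  - intros u (h1 & h2 & h3).
    destruct (polar (fst (resid r x n u)) (snd (resid r x n u))) as (h & nh & hh & hn & e1 & e2).
    assert (E : dot (resid r x n u) (resid r x n u) = h ^ 2).
    { unfold dot; rewrite e1, e2. unfold unitv in hn.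
      transitivity (h ^ 2 * (fst nh ^ 2 + snd nh ^ 2)); [ring|rewrite hn; ring]. }
    rewrite E in h2, h3.
    assert (b1 : rho - rn <= h).
    { destruct hmax; destruct (Rle_or_lt (rho - rn) h); auto; nra. }
    assert (b2 : h <= tau + rn) by nra.
    assert (dn : dot nh nh = 1) by (unfold dot, unitv in *; lra).
    assert (dn' : dot nh (- fst nh, - snd nh) = -1) by (unfold dot, unitv in *; cbn [fst snd]; lra).
    destruct (arc_type h rn rho tau) as [K|K]; auto.
    + exists nh. split; [now apply unitc_upd|].
      rewrite resid_S, resid_upd_out, upd_eq, (dist2_polar _ h nh), dn by auto. fold rn.
      destruct (Rle_or_lt rn h); nra.
    + exists (- fst nh, - snd nh). split; [apply unitc_upd; auto; now apply unitv_opp|].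
      rewrite resid_S, resid_upd_out, upd_eq, (dist2_polar _ h nh), dn' by (auto; now apply unitv_opp). fold rn.
      nra.
  - intros u h; apply h; lia.
  - apply adherent_annulus.
  - intros Q hQ u v v' dv dv' qv.
    destruct (polar (fst (resid r x n u)) (snd (resid r x n u))) as (h & nh & hh & hn & e1 & e2).
    assert (U : unitc n u).
    { intros j hj. destruct dv as (h1 & _). specialize (h1 j ltac:(lia)). rewrite upd_neq in h1 by lia; auto. }
    assert (C : forall w, unitv w -> (annulus r x (S n) rho tau (upd u n w) <->
       rho ^ 2 <= h ^ 2 + rn ^ 2 - 2 * rn * h * dot nh w <= tau ^ 2)).
    { intros w hw'. unfold annulus. rewrite resid_S, resid_upd_out, upd_eq, (dist2_polar _ h nh) by auto.
      fold rn. split; [intros [_ K]; exact K|intros K; split; [now apply unitc_upd|exact K]]. }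
    assert (uv : unitv v) by (destruct dv as (h1 & _); specialize (h1 n ltac:(lia)); now rewrite upd_eq in h1).
    assert (uv' : unitv v') by (destruct dv' as (h1 & _); specialize (h1 n ltac:(lia)); now rewrite upd_eq in h1).
    apply (C v uv) in dv; apply (C v' uv') in dv'.
    assert (0 <= rn * h) by nra.
    (* If the inner bound is automatic the arc is centred at [nh]; if the outer one is, at the
       opposite vector. *)
    destruct (arc_type h rn rho tau) as [K|K]; auto.
    + assert (A : forall w, unitv w -> rho ^ 2 <= h ^ 2 + rn ^ 2 - 2 * rn * h * dot nh w <= tau ^ 2 ->
         (Q (upd u n w) <-> Q (upd u n nh))).
      { intros w hw' dw. apply (arc_constant n _ Q u nh w hn hw' hQ).
        intros w' uw' hd. apply (C w' uw'). pose proof (dot_bound nh w' hn uw'). nra. }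
      rewrite A by auto. now apply (A v).
    + assert (A : forall w, unitv w -> rho ^ 2 <= h ^ 2 + rn ^ 2 - 2 * rn * h * dot nh w <= tau ^ 2 ->
         (Q (upd u n w) <-> Q (upd u n (- fst nh, - snd nh)))).
      { intros w hw' dw. apply (arc_constant n _ Q u _ w (unitv_opp _ hn) hw' hQ).
        assert (O : forall p, dot (- fst nh, - snd nh) p = - dot nh p) by (intros; unfold dot; cbn [fst snd]; ring).
        intros w' uw' hd. rewrite !O in hd. apply (C w' uw'). pose proof (dot_bound nh w' hn uw'). nra. }
      rewrite A by auto. now apply (A v).
Qed.

(** The width never shrinks: it grows by [2 * r n], or, when the inner radius is cut off at 0,
    becomes [tau + r n], which is at least [tau - rho]. With no bars left any two configurations are
    near each other. *)
Lemma annulus_connected r x n : forall rho tau, 0 <= rho ->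
  (forall j, (j < n)%nat -> 0 <= r j /\ 2 * r j <= tau - rho) ->
  connected_cfg n (annulus r x n rho tau).
Proof.
  induction n; intros rho tau hrho hr.
  - intros Q hQ u u' du du' qu. destruct (hQ u du) as (e & he & H).
    apply (H u'); auto. intros j hj; lia.
  - destruct (hr n ltac:(lia)) as [h1 h2].
    apply annulus_step; auto. apply IHn; [apply Rmax_l|].
    intros j hj; destruct (hr j ltac:(lia)) as [h3 h4]; split; auto.
    unfold Rmax; destruct (Rle_dec 0 (rho - r n)); lra.
Qed.

(* The two-bar linkage with lengths a >= b closing the residual vector, with prescribed orientation. *)
Definition closing r x k a b ka (w : cfg) : Prop :=
  unitc (S k) w /\
  (let y := resid r x k w in
   dot (fst y - b * fst (w k), snd y - b * snd (w k))
       (fst y - b * fst (w k), snd y - b * snd (w k)) = a ^ 2 /\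
   0 <= ka * cr y (w k)).

Lemma adherent_closing r x k a b ka w :
  adherent (S k) (closing r x k a b ka) w -> closing r x k a b ka w.
Proof.
  intros had. assert (hF := filt_nhds (S k) w 0).
  destruct (lim_resid r x (S k) w k ltac:(lia)) as [l1 l2].
  pose proof (lim_nhds_fst (S k) w 0 k ltac:(lia)) as l3.
  pose proof (lim_nhds_snd (S k) w 0 k ltac:(lia)) as l4.
  split; [|split].
  - apply (adherent_unitc (S k) (S k) (closing r x k a b ka)); auto. intros u' h; apply h.
  - apply (adherent_eq (S k) (closing r x k a b ka) w (fun w => let y := resid r x k w in
      dot (fst y - b * fst (w k), snd y - b * snd (w k))
       (fst y - b * fst (w k), snd y - b * snd (w k)))); auto.
    + unfold dot; cbn [fst snd]; lims.
    + intros u' h; apply h.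
  - assert (- (ka * cr (resid r x k w) (w k)) <= 0); [|lra].
    apply (adherent_le (S k) (closing r x k a b ka) w (fun w => - (ka * cr (resid r x k w) (w k)))); auto.
    + unfold cr; lims.
    + intros u' h; destruct h as (_ & _ & h); cbv zeta in h; lra.
Qed.

(** Heron's factorisation: 4 b^2 h^2 - (a^2 - h^2 - b^2)^2 = ((a + b)^2 - h^2) (h^2 - (a - b)^2). *)
Lemma triangle_bound a b h : 0 < b -> 0 <= h -> 0 <= a - b <= h -> h <= a + b ->
  ((a ^ 2 - h ^ 2 - b ^ 2) / (2 * b)) ^ 2 <= h ^ 2.
Proof.
  intros. replace (((a ^ 2 - h ^ 2 - b ^ 2) / (2 * b)) ^ 2)
    with ((a ^ 2 - h ^ 2 - b ^ 2) ^ 2 / (4 * b ^ 2)) by (field; lra).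
  apply Rmult_le_reg_r with (4 * b ^ 2); [nra|].
  unfold Rdiv; rewrite Rmult_assoc, Rinv_l by nra. rewrite Rmult_1_r.
  assert (0 <= ((a + b) ^ 2 - h ^ 2)) by nra.
  assert (0 <= (h ^ 2 - (a - b) ^ 2)) by nra.
  assert (0 <= ((a + b) ^ 2 - h ^ 2) * (h ^ 2 - (a - b) ^ 2)) by nra.
  nra.
Qed.

(** Over the annulus the prescribed orientation determines the triangle, so fibres are single
    points. The exception is a zero residual, which forces [a = b] and leaves the whole circle,
    still connected. *)
Lemma closing_connected r x k a b ka : 0 < b <= a -> ka ^ 2 = 1 ->
  connected_cfg k (annulus r x k (a - b) (a + b)) ->
  connected_cfg (S k) (closing r x k a b ka).
Proof.
  intros hab hka. apply connected_cfg_fibration.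
  - intros u (h1 & h2 & h3); cbv zeta in *. split; [eapply unitc_le; [|exact h1]; lia|].
    destruct (polar (fst (resid r x k u)) (snd (resid r x k u))) as (h & nh & hh & hn & e1 & e2).
    rewrite (dist2_polar _ h nh) in h2 by (auto; apply h1; lia).
    pose proof (dot_bound nh (u k) hn (h1 k ltac:(lia))) as hd.
    set (c := dot nh (u k)) in *.
    assert (E : dot (resid r x k u) (resid r x k u) = h ^ 2).
    { unfold dot; rewrite e1, e2. unfold unitv in hn.
      transitivity (h ^ 2 * (fst nh ^ 2 + snd nh ^ 2)); [ring|rewrite hn; ring]. }
    rewrite E. assert (0 <= b * h) by nra.
    assert (h - b <= a) by (assert ((h - b) ^ 2 <= a ^ 2) by nra; nra).
    assert (a <= h + b) by (assert (a ^ 2 <= (h + b) ^ 2) by nra; nra).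
    split; nra.
  - intros u (h1 & h2 & h3).
    set (y := resid r x k u) in *.
    assert (hn : 0 <= dot y y) by (unfold dot; nra).
    destruct (Req_dec (dot y y) 0) as [E|E].
    + assert (a = b) by nra. subst b.
      assert (y0 : fst y = 0 /\ snd y = 0) by (unfold dot in E; split; nra).
      exists (1, 0). split; [apply unitc_upd; auto; unfold unitv; simpl; ring|].
      cbv zeta; rewrite resid_upd_out, upd_eq by auto. fold y. unfold dot, cr; cbn [fst snd].
      destruct y0 as [-> ->]; split; [ring|lra].
    + set (h := sqrt (dot y y)).
      assert (hh : h ^ 2 = dot y y) by (unfold h; simpl; rewrite Rmult_1_r; now apply sqrt_sqrt).
      assert (hp : 0 <= h) by apply sqrt_pos.
      assert (N : (- fst y) ^ 2 + (- snd y) ^ 2 = h ^ 2) by (rewrite hh; unfold dot; ring).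
      (* The equation |y - b v| = a is solved as |-y + b v| = a; replacing y by -y reverses the
         orientation, hence [- ka]. *)
      destruct (solv_ok (- ka) b (- fst y) (- snd y) a) as (s1 & s2 & s3); try lra.
      { rewrite N. apply triangle_bound; try lra; [split; [lra|nra]|nra]. }
      set (v := solv (- ka) b (- fst y) (- snd y) a) in *.
      exists v; split; [now apply unitc_upd|].
      cbv zeta; rewrite resid_upd_out, upd_eq by auto. fold y. split.
      * rewrite <- s2; unfold dot; cbn [fst snd]; ring.
      * replace (ka * cr y v) with (- ka * cr (- fst y, - snd y) v); auto.
        unfold cr; cbn [fst snd]; ring.
  - intros u h; apply h; lia.
  - apply adherent_closing.
  - intros Q hQ u v v' (d1 & d2 & d3) (d1' & d2' & d3') qv; cbv zeta in *.
    rewrite resid_upd_out, upd_eq in * by auto.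
    assert (U : unitc k u).
    { intros j hj. specialize (d1 j ltac:(lia)). rewrite upd_neq in d1 by lia; auto. }
    assert (uv : unitv v) by (specialize (d1 k ltac:(lia)); now rewrite upd_eq in d1).
    assert (uv' : unitv v') by (specialize (d1' k ltac:(lia)); now rewrite upd_eq in d1').
    set (y := resid r x k u) in *.
    destruct (Req_dec (dot y y) 0) as [E|E].
    + assert (y0 : fst y = 0 /\ snd y = 0) by (unfold dot in E; split; nra).
      destruct y0 as [y1 y2].
      assert (hu : unitv (1, 0)) by (unfold unitv; simpl; ring).
      assert (A : forall w, unitv w -> (Q (upd u k w) <-> Q (upd u k (1, 0)))).
      { intros w uw. apply (arc_constant k _ Q u _ w hu uw hQ).
        intros w' uw' _. split; [now apply unitc_upd|].
        cbv zeta; rewrite resid_upd_out, upd_eq by auto. fold y.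
        assert (b ^ 2 = a ^ 2).
        { rewrite <- d2, y1, y2. unfold dot, unitv in *; cbn [fst snd].
          transitivity (b ^ 2 * (fst v ^ 2 + snd v ^ 2)); [rewrite uv|]; ring. }
        unfold dot, cr; cbn [fst snd]; rewrite y1, y2; split; [|lra].
        rewrite <- H. unfold unitv in uw'.
        transitivity (b ^ 2 * (fst w' ^ 2 + snd w' ^ 2)); [|rewrite uw']; ring. }
      rewrite A by auto. now apply (A v).
    + assert (S : forall w, unitv w ->
        dot (fst y - b * fst w, snd y - b * snd w) (fst y - b * fst w, snd y - b * snd w) = a ^ 2 ->
        0 <= ka * cr y w -> solv (- ka) b (- fst y) (- snd y) a = w).
      { intros w uw e1 e2. apply solv_uniq; auto.
        - rewrite <- hka; ring.
        - lra.
        - unfold dot in E; nra.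
        - rewrite <- e1; unfold dot; cbn [fst snd]; ring.
        - replace (- ka * cr (- fst y, - snd y) w) with (ka * cr y w); auto.
          unfold cr; cbn [fst snd]; ring. }
      rewrite <- (S v'), (S v); auto.
Qed.

(** The sum is turned onto the first axis, which for positive [x] leaves one representative of each
    rotation class. *)
Definition fibre l k x (u : cfg) : Prop := unitc k u /\ sx l k u = x /\ sy l k u = 0.

(** The sheet is a continuous image of a [closing] space, whose annulus [l ia - l ib, l ia + l ib]
    has width [2 * l ib], enough for every other bar. *)
Lemma sheet_connected l k ia ib x ka :
  (ia < k)%nat -> (ib < k)%nat -> ia <> ib -> (forall j, (j < k)%nat -> 0 < l j) ->
  l ib <= l ia -> (forall j, (j < k)%nat -> j <> ia -> j <> ib -> l j <= l ib) -> ka ^ 2 = 1 ->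
  forall Q, locally_constant k (fibre l k x) Q -> forall u u',
  fibre l k x u -> fibre l k x u' -> 0 <= ka * cr (u ia) (u ib) -> 0 <= ka * cr (u' ia) (u' ib) ->
  Q u -> Q u'.
Proof.
  intros hia hib hne hl hab hr hka Q hQ u u' fu fu' cu cu' qu.
  set (a := l ia) in *; set (b := l ib) in *.
  assert (ha : 0 < a) by (apply hl; auto). assert (hb : 0 < b) by (apply hl; auto).
  set (r := upd (upd l ib 0) ia 0).
  set (D := closing r x k a b ka).
  assert (hD : connected_cfg (S k) D).
  { apply closing_connected; [lra|auto|]. apply annulus_connected; [lra|].
    intros j hj. unfold r, upd.
    destruct (Nat.eqb_spec j ia); [lra|]. destruct (Nat.eqb_spec j ib); [lra|].
    pose proof (hr j hj n n0). pose proof (hl j hj). lra. }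
  (* The closing equation forces the direction of bar [ia]. *)
  set (ua := fun w : cfg => ((fst (resid r x k w) - b * fst (w k)) / a,
                             (snd (resid r x k w) - b * snd (w k)) / a)).
  set (cf := fun w => upd (upd w ia (ua w)) ib (w k)).
  assert (cfD : forall w, D w -> fibre l k x (cf w)).
  { intros w (d1 & d2 & _); cbv zeta in d2. split; [|split].
    - intros j hj; unfold cf, upd. destruct (Nat.eqb_spec j ib); [apply d1; lia|].
      destruct (Nat.eqb_spec j ia); [|apply d1; lia].
      unfold unitv, ua; cbn [fst snd]. unfold dot in d2; cbn [fst snd] in d2.
      transitivity (a ^ 2 / a ^ 2); [rewrite <- d2 at 1|]; field; lra.
    - unfold cf. rewrite sx_upd, sx_upd by auto. rewrite (upd_neq _ l ib 0 ia) by auto.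
      fold a b r. unfold ua; cbn [fst snd]. unfold resid at 1; cbn [fst]. field; lra.
    - unfold cf. rewrite sy_upd, sy_upd by auto. rewrite (upd_neq _ l ib 0 ia) by auto.
      fold a b r. unfold ua; cbn [fst snd]. unfold resid at 1; cbn [snd]. field; lra. }
  assert (hQ' : locally_constant (S k) D (fun w => Q (cf w))).
  { intros w dw. destruct (hQ (cf w) (cfD w dw)) as (e & he & H).
    assert (hF := filt_nhds (S k) w 0).
    destruct (lim_resid r x (S k) w k ltac:(lia)) as [l1 l2].
    pose proof (lim_nhds_fst (S k) w 0 k ltac:(lia)) as l3.
    pose proof (lim_nhds_snd (S k) w 0 k ltac:(lia)) as l4.
    assert (K : nhds (S k) w 0 (fun q => near k (cf w) (cf (fst q)) e)).
    { apply (filt_forall_lt _ _ (fun j (q : cfg * R) => Rabs (fst (cf (fst q) j) - fst (cf w j)) < e /\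
          Rabs (snd (cf (fst q) j) - snd (cf w j)) < e)); auto.
      intros j hj. apply (proj1 (proj2 hF)).
      - apply (fun h : lim _ _ _ => h e he). unfold cf, upd. destruct (Nat.eqb_spec j ib); auto.
        destruct (Nat.eqb_spec j ia); [|apply lim_nhds_fst; lia]. unfold ua; cbn [fst snd]; lims; lra.
      - apply (fun h : lim _ _ _ => h e he). unfold cf, upd. destruct (Nat.eqb_spec j ib); auto.
        destruct (Nat.eqb_spec j ia); [|apply lim_nhds_snd; lia]. unfold ua; cbn [fst snd]; lims; lra. }
    destruct K as (d & hd & K). exists d; split; auto. intros w' dw' hn.
    apply H; auto. apply (K w' 0); auto. replace (0 - 0) with 0 by ring; now rewrite Rabs_R0. }
  (* Copying slot [ib] to slot [k] inverts [cf] on the first [k] coordinates, the only ones [Q]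
     sees. The residual is a u_a + b u_b, so its cross product with u_b has the sign of u_a x
     u_b. *)
  assert (back : forall v, fibre l k x v -> 0 <= ka * cr (v ia) (v ib) ->
    D (upd v k (v ib)) /\ (Q v <-> Q (cf (upd v k (v ib))))).
  { intros v (v1 & v2 & v3) cv.
    assert (E : forall w, w = v ib -> resid r x k (upd v k w) =
      (a * fst (v ia) + b * fst (v ib), a * snd (v ia) + b * snd (v ib))).
    { intros w ->. rewrite resid_upd_out by auto. unfold resid. rewrite <- v2.
      replace (sy r k v) with (sy r k v - sy l k v) by (rewrite v3; ring).
      rewrite (sx_split l k v ib), (sy_split l k v ib), (sx_split (upd l ib 0) k v ia),
        (sy_split (upd l ib 0) k v ia) by auto.
      rewrite (upd_neq _ l ib 0 ia) by auto. fold a b r. f_equal; ring. }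
    pose proof (v1 ia hia) as ua1. pose proof (v1 ib hib) as ub1.
    assert (dv : D (upd v k (v ib))).
    { split; [apply unitc_upd; auto|]. cbv zeta. rewrite upd_eq, E by auto. cbn [fst snd].
      unfold dot, cr, unitv in *; cbn [fst snd]; split.
      - transitivity (a ^ 2 * (fst (v ia) ^ 2 + snd (v ia) ^ 2)); [ring|rewrite ua1; ring].
      - replace (ka * ((a * fst (v ia) + b * fst (v ib)) * snd (v ib) -
          (a * snd (v ia) + b * snd (v ib)) * fst (v ib))) with
          (a * (ka * (fst (v ia) * snd (v ib) - snd (v ia) * fst (v ib)))) by ring.
        nra. }
    split; auto. destruct (hQ v ltac:(now repeat split)) as (e & he & H).
    apply H; auto.
    assert (A : forall j, (j < k)%nat -> cf (upd v k (v ib)) j = v j).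
    { intros j hj; unfold cf. rewrite upd_eq. unfold ua. rewrite E, upd_eq by auto; cbn [fst snd].
      unfold upd. destruct (Nat.eqb_spec j ib); [now subst|].
      destruct (Nat.eqb_spec j ia).
      - subst j. apply injective_projections; cbn [fst snd]; field; lra.
      - destruct (Nat.eqb_spec j k); auto; lia. }
    intros j hj; rewrite A by auto. split; apply Rabs_def1; lra. }
  destruct (back u fu cu) as [du Eu], (back u' fu' cu') as [du' Eu'].
  apply Eu'. apply (hD _ hQ' (upd u k (u ib))); auto. now apply Eu.
Qed.

(** * Sections of the length function *)

(** Three rigid classes of bars; every value of [g] except 0 and 1 means the third. Thus
    [gsum w g 1 0 0 k] is the total length of class 0, and similarly for the others. *)
Definition pick {T} (g : nat -> nat) (p q r : T) (j : nat) : T :=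
  if Nat.eqb (g j) 0 then p else if Nat.eqb (g j) 1 then q else r.

Definition gsum w g p q r n := sm (fun j => w j * pick g p q r j) n.

Lemma gsum_lin w g p q r n :
  gsum w g p q r n = p * gsum w g 1 0 0 n + q * gsum w g 0 1 0 n + r * gsum w g 0 0 1 n.
Proof.
  unfold gsum. rewrite <- !sm_scal, <- !sm_plus. apply sm_ext; intros j _.
  unfold pick. destruct (Nat.eqb (g j) 0), (Nat.eqb (g j) 1); ring.
Qed.

Lemma gsum_total w g n : gsum w g 1 0 0 n + gsum w g 0 1 0 n + gsum w g 0 0 1 n = sm w n.
Proof.
  unfold gsum. rewrite <- !sm_plus. apply sm_ext; intros j _.
  unfold pick. destruct (Nat.eqb (g j) 0), (Nat.eqb (g j) 1); ring.
Qed.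

Lemma sx_pick w g p q r n : sx w n (pick g p q r) =
  fst p * gsum w g 1 0 0 n + fst q * gsum w g 0 1 0 n + fst r * gsum w g 0 0 1 n.
Proof.
  rewrite <- gsum_lin. apply sm_ext; intros j _; unfold pick.
  now destruct (Nat.eqb (g j) 0), (Nat.eqb (g j) 1).
Qed.

Lemma sy_pick w g p q r n : sy w n (pick g p q r) =
  snd p * gsum w g 1 0 0 n + snd q * gsum w g 0 1 0 n + snd r * gsum w g 0 0 1 n.
Proof.
  rewrite <- gsum_lin. apply sm_ext; intros j _; unfold pick.
  now destruct (Nat.eqb (g j) 0), (Nat.eqb (g j) 1).
Qed.

Lemma unitc_pick k g p q r : unitv p -> unitv q -> unitv r -> unitc k (pick g p q r).
Proof. intros hp hq hr j _; unfold pick; now destruct (Nat.eqb (g j) 0), (Nat.eqb (g j) 1). Qed.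

Lemma pth_sub l k al lo hi lo' hi' X : lo <= lo' -> hi' <= hi -> pth l k al lo hi X -> pth l k al lo' hi' X.
Proof. intros h1 h2 [c o]; split; auto. intros t ht; apply o; lra. Qed.

Definition east : R * R := (1, 0).
Definition west : R * R := (-1, 0).

Lemma unitv_east : unitv east. Proof. unfold unitv; simpl; ring. Qed.
Lemma unitv_west : unitv west. Proof. unfold unitv; simpl; ring. Qed.

Lemma triangle_bound_abs A B y : 0 < A -> 0 < B -> Rabs (A - B) <= y <= A + B ->
  ((y ^ 2 - (A ^ 2 + 0 ^ 2) - B ^ 2) / (2 * B)) ^ 2 <= A ^ 2 + 0 ^ 2.
Proof.
  intros hA hB [h1 h2].
  assert (A - B <= y /\ B - A <= y).
  { pose proof (Rle_abs (A - B)); pose proof (Rle_abs (- (A - B))). rewrite Rabs_Ropp in *. lra. }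
  replace ((y ^ 2 - (A ^ 2 + 0 ^ 2) - B ^ 2) / (2 * B)) with ((y ^ 2 - A ^ 2 - B ^ 2) / (2 * B)) by (field; lra).
  replace (((y ^ 2 - A ^ 2 - B ^ 2) / (2 * B)) ^ 2)
    with ((y ^ 2 - A ^ 2 - B ^ 2) ^ 2 / (4 * B ^ 2)) by (field; lra).
  apply Rmult_le_reg_r with (4 * B ^ 2); [nra|].
  unfold Rdiv; rewrite Rmult_assoc, Rinv_l by nra. rewrite Rmult_1_r.
  assert (0 <= (A + B) ^ 2 - y ^ 2) by nra.
  assert (0 <= y ^ 2 - (A - B) ^ 2) by nra.
  assert (0 <= ((A + B) ^ 2 - y ^ 2) * (y ^ 2 - (A - B) ^ 2)) by nra.
  nra.
Qed.

Section Bars.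
Variables (w : nat -> R) (k : nat) (g : nat -> nat) (ka : R).
Hypothesis hka : ka ^ 2 = 1.
Let A := gsum w g 1 0 0 k.
Let B := gsum w g 0 1 0 k.
Let C := gsum w g 0 0 1 k.

(* Class 0 is rigid and points along east, the union of classes 1 and 2 is a second rigid bar. *)
Lemma bar2_section : 0 < A -> 0 < B + C -> exists X,
  pth w k (fun y => y) (Rabs (A - (B + C))) (A + (B + C)) X /\
  (forall j, X (A + (B + C)) j = east) /\
  (forall j, X (Rabs (A - (B + C))) j = pick g east west west j) /\
  (forall y i j, Rabs (A - (B + C)) <= y <= A + (B + C) -> g i = O -> g j <> O ->
     0 <= ka * cr (X y i) (X y j)).
Proof.
  intros hA hD. set (D := B + C) in *.
  set (e := fun y => solv ka D A 0 y).
  assert (hn : 0 < A ^ 2 + 0 ^ 2) by nra.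
  assert (he : forall y, Rabs (A - D) <= y <= A + D -> unitv (e y) /\
     (A + D * fst (e y)) ^ 2 + (0 + D * snd (e y)) ^ 2 = y ^ 2 /\ 0 <= ka * cr (A, 0) (e y)).
  { intros y hy; apply solv_ok; auto. now apply triangle_bound_abs. }
  exists (fun y => pick g east (e y) (e y)); split; [split|split; [|split]].
  - intros j _.
    assert (K : forall t, lim (at_ t) (fun y => fst (e y)) (fst (e t)) /\
                          lim (at_ t) (fun y => snd (e y)) (snd (e t))).
    { intros t; unfold e. apply (lim_solv _ (at_ t) ka D (fun _ => A) (fun _ => 0) (fun y => y));
        try lra; lims. }
    unfold pick; destruct (Nat.eqb (g j) 0), (Nat.eqb (g j) 1); split; intros t; try apply K; lims.
  - intros y hy; destruct (he y hy) as (h1 & h2 & _); split.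
    + apply unitc_pick; auto using unitv_east.
    + rewrite sx_pick, sy_pick. fold A B C. rewrite <- h2; unfold D, east; simpl; ring.
  - intros j. unfold e; rewrite (solv_uniq ka D A 0 (A + D) east); auto using unitv_east.
    + unfold pick; now destruct (Nat.eqb (g j) 0), (Nat.eqb (g j) 1).
    + unfold east; simpl; ring.
    + unfold east, cr; simpl; lra.
  - intros j. unfold e; rewrite (solv_uniq ka D A 0 (Rabs (A - D)) west); auto using unitv_west.
    + rewrite pow2_abs. unfold west; simpl; ring.
    + unfold west, cr; simpl; lra.
  - intros y i j hy hi hj. destruct (he y hy) as (_ & _ & h3).
    assert (K : pick g east (e y) (e y) j = e y).
    { unfold pick. destruct (Nat.eqb_spec (g j) 0); [tauto|]. now destruct (Nat.eqb (g j) 1). }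
    rewrite K. unfold pick at 1; rewrite hi; simpl Nat.eqb; cbv iota.
    unfold cr, east in *; cbn [fst snd] in *. nra.
Qed.

(* Class 0 together with the closing vector of length y is one side of a triangle whose other
   sides are the classes 1 and 2; class 0 points against the closing vector. *)
Lemma bar3_section : 0 < B -> 0 < C -> 0 <= A -> (forall j, (j < k)%nat -> g j = O -> 0 < A) ->
  A <= B + C -> exists X,
  pth w k (fun y => y) (Rmax 0 (Rabs (B - C) - A)) (B + C - A) X /\
  (forall j, (j < k)%nat -> X (B + C - A) j = pick g west east east j) /\
  (forall y i j, Rmax 0 (Rabs (B - C) - A) <= y <= B + C - A -> g i = 1%nat -> g j = 2%nat ->
     0 <= ka * cr (X y i) (X y j)) /\
  (forall y i j, Rmax 0 (Rabs (B - C) - A) <= y <= B + C - A -> (i < k)%nat -> g i = O -> g j = 1%nat ->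
     0 <= ka * cr (X y i) (X y j)).
Proof.
  intros hB hC hA hgA hABC.
  set (e := fun y => solv ka C B 0 (A + y)).
  (* An empty class gets an arbitrary direction. [Rmax 0 y] keeps the denominator positive outside
     the segment, where continuity is still required. *)
  set (f := fun y => if Req_EM_T A 0 then east else
     (- (B + C * fst (e y)) / (A + Rmax 0 y), - (C * snd (e y)) / (A + Rmax 0 y))).
  assert (hn : 0 < B ^ 2 + 0 ^ 2) by nra.
  assert (hm : forall y, Rmax 0 (Rabs (B - C) - A) <= y -> 0 <= y /\ Rabs (B - C) <= A + y).
  { intros y hy. pose proof (Rmax_l 0 (Rabs (B - C) - A)); pose proof (Rmax_r 0 (Rabs (B - C) - A)). lra. }
  assert (he : forall y, Rmax 0 (Rabs (B - C) - A) <= y <= B + C - A -> unitv (e y) /\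
     (B + C * fst (e y)) ^ 2 + (0 + C * snd (e y)) ^ 2 = (A + y) ^ 2 /\ 0 <= ka * cr (B, 0) (e y)).
  { intros y [hy1 hy2]; destruct (hm y hy1). apply solv_ok; auto. apply triangle_bound_abs; auto; lra. }
  assert (hf : forall y, Rmax 0 (Rabs (B - C) - A) <= y <= B + C - A ->
     unitv (f y) /\ (A <> 0 -> B + C * fst (e y) = - (A + y) * fst (f y) /\
                     C * snd (e y) = - (A + y) * snd (f y))).
  { intros y hy. destruct (he y hy) as (_ & h2 & _), (hm y (proj1 hy)) as [h3 _].
    unfold f; destruct (Req_EM_T A 0) as [|nA]; [split; [apply unitv_east|tauto]|].
    rewrite Rmax_right by auto. unfold unitv; cbn [fst snd]; split.
    - transitivity (((B + C * fst (e y)) ^ 2 + (0 + C * snd (e y)) ^ 2) / (A + y) ^ 2); [field; lra|].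
      rewrite h2; field; lra.
    - intros _; split; field; lra. }
  assert (eh : e (B + C - A) = east).
  { unfold e; apply solv_uniq; auto using unitv_east; [unfold east; simpl; ring|unfold east, cr; simpl; lra]. }
  exists (fun y => pick g (f y) east (e y)); split; [split|split; [|split]].
  - intros j _.
    assert (K : forall t, lim (at_ t) (fun y => fst (e y)) (fst (e t)) /\
                          lim (at_ t) (fun y => snd (e y)) (snd (e t))).
    { intros t; unfold e. apply (lim_solv _ (at_ t) ka C (fun _ => B) (fun _ => 0) (fun y => A + y));
        try lra; lims. }
    assert (K' : forall t, lim (at_ t) (fun y => fst (f y)) (fst (f t)) /\
                          lim (at_ t) (fun y => snd (f y)) (snd (f t))).
    { intros t. destruct (K t). unfold f; destruct (Req_EM_T A 0); [split; lims|]; cbn [fst snd].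
      pose proof (Rmax_l 0 t). split; lims; lra. }
    unfold pick; destruct (Nat.eqb (g j) 0), (Nat.eqb (g j) 1); split; intros t;
      first [apply K | apply K' | lims].
  - intros y hy; destruct (he y hy) as (h1 & h2 & _), (hf y hy) as (h3 & h4); split.
    + apply unitc_pick; auto using unitv_east.
    + rewrite sx_pick, sy_pick. fold A B C. unfold east; cbn [fst snd].
      destruct (Req_dec A 0) as [E|E].
      * rewrite E in *. transitivity ((B + C * fst (e y)) ^ 2 + (0 + C * snd (e y)) ^ 2); [ring|].
        rewrite h2; ring.
      * destruct (h4 E) as [h5 h6]. unfold unitv in h3.
        transitivity ((A * fst (f y) + (B + C * fst (e y))) ^ 2 + (A * snd (f y) + C * snd (e y)) ^ 2); [ring|].
        rewrite h5, h6. transitivity (y ^ 2 * (fst (f y) ^ 2 + snd (f y) ^ 2)); [ring|rewrite h3; ring].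
  - intros j hj. unfold pick. destruct (Nat.eqb_spec (g j) 0) as [E|E]; [|now rewrite eh].
    unfold f; rewrite eh. pose proof (hgA j hj E).
    destruct (Req_EM_T A 0); [lra|]. rewrite Rmax_right by lra.
    unfold east, west; cbn [fst snd]; f_equal; field; lra.
  - intros y i j hy hi hj. destruct (he y hy) as (_ & _ & h). unfold pick; rewrite hi, hj; simpl Nat.eqb; cbv iota.
    unfold cr, east in *; cbn [fst snd] in *. nra.
  - intros y i j hy hik hi hj. destruct (he y hy) as (_ & _ & h), (hm y (proj1 hy)) as [h3 _].
    pose proof (hgA i hik hi).
    unfold pick; rewrite hi, hj; simpl Nat.eqb; cbv iota.
    unfold f; destruct (Req_EM_T A 0); [lra|]. rewrite Rmax_right by auto.
    unfold cr, east in *; cbn [fst snd] in *.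
    replace (ka * (- (B + C * fst (e y)) / (A + y) * 0 - - (C * snd (e y)) / (A + y) * 1))
      with (ka * (B * snd (e y) - 0 * fst (e y)) * (C / (B * (A + y)))) by (field; lra).
    apply Rmult_le_pos; auto. left; apply Rdiv_lt_0_compat; auto. apply Rmult_lt_0_compat; lra.
Qed.
End Bars.

Lemma sm_indicator w k i : (i < k)%nat -> sm (fun j => if Nat.eqb j i then w j else 0) k = w i.
Proof.
  intros hi. rewrite (sm_ext _ (upd (fun _ => 0) i (w i)) k).
  - rewrite sm_upd by auto. replace (sm (fun _ => 0) k) with 0; [ring|].
    clear hi; induction k; simpl; lra.
  - intros j _; unfold upd; destruct (Nat.eqb_spec j i); now subst.
Qed.

(** A discrete intermediate value property; for [c] half the total it finds the bar straddling the
    midpoint. *)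
Lemma half_index w n c : 0 <= c < sm w n -> exists j, (j < n)%nat /\ sm w j <= c < sm w (S j).
Proof.
  induction n; intros h; [simpl in h; lra|].
  destruct (Rle_or_lt (sm w n) c) as [K|K].
  - exists n; split; [lia|lra].
  - destruct (IHn ltac:(lra)) as (j & hj & H). exists j; split; [lia|auto].
Qed.

Definition around (i j : nat) : nat := if Nat.eqb j i then O else if Nat.ltb j i then 1%nat else 2%nat.

Lemma gsum_around_lt w i n : gsum w (around i) 0 1 0 n = sm w (Nat.min n i).
Proof.
  induction n; [reflexivity|]. unfold gsum in *; cbn [sm]. rewrite IHn. unfold pick, around.
  destruct (Nat.eqb_spec n i) as [->|E].
  - rewrite Nat.min_id, Nat.min_r by lia. simpl. ring.
  - destruct (Nat.ltb_spec n i).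
    + rewrite !Nat.min_l by lia. simpl. ring.
    + rewrite !Nat.min_r by lia. simpl. ring.
Qed.

Lemma gsum_around_eq w i n : (i < n)%nat -> gsum w (around i) 1 0 0 n = w i.
Proof.
  intros hi. rewrite <- (sm_indicator w n i hi). apply sm_ext; intros j _. unfold pick, around.
  destruct (Nat.eqb_spec j i); [simpl; ring|]. destruct (Nat.ltb j i); simpl; ring.
Qed.

Lemma flip_rote k u v : (forall j, (j < k)%nat -> v j = (- fst (u j), - snd (u j))) -> rote k u v.
Proof.
  intros h; exists (-1), 0; split; [ring|]. intros j hj; rewrite h by auto.
  unfold rotp; f_equal; ring.
Qed.

(* G marks the longest bar M and the weightless bars that are to follow it.  If 2 w M < sm w k, the
   bars are cut into three consecutive groups satisfying the triangle inequality. *)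
Lemma linkage_section w k M (G : nat -> bool) : (M < k)%nat ->
  (forall j, (j < k)%nat -> 0 <= w j <= w M) -> G M = true ->
  (forall j, (j < k)%nat -> if G j then j = M \/ w j = 0 else 0 < w j) ->
  exists X, pth w k (fun y => y) (Rmax 0 (2 * w M - sm w k)) (sm w k) X /\
    (forall j, (j < k)%nat -> X (sm w k) j = east) /\
    (0 < 2 * w M - sm w k ->
       forall j, (j < k)%nat -> X (2 * w M - sm w k) j = if G j then east else west).
Proof.
  intros hM hw GM hG. set (T := sm w k).
  assert (hT : w M <= T) by (apply sm_term_le; auto; intros; apply hw; auto).
  pose proof (hw M hM) as hwM.
  destruct (classic (forall j, (j < k)%nat -> G j = true)) as [K|K].
  - assert (TM : T = w M).
    { unfold T; rewrite <- (sm_indicator w k M hM). apply sm_ext; intros j hj.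
      pose proof (hG j hj) as h; rewrite (K j hj) in h.
      destruct (Nat.eqb_spec j M); auto; destruct h; [tauto|auto]. }
    exists (fun _ _ => east); split; [split|split].
    + intros; split; intros t; lims.
    + intros y hy. assert (y = T).
      { pose proof (Rmax_r 0 (2 * w M - T)); lra. }
      subst y. split; [intros j _; apply unitv_east|].
      unfold sx, sy, east; cbn [fst snd].
      rewrite (sm_ext (fun j => w j * 1) w) by (intros; ring).
      rewrite (sm_ext (fun j => w j * 0) (fun j => 0 * w j)) by (intros; ring).
      rewrite sm_scal. fold T. ring.
    + auto.
    + intros _ j hj; now rewrite K.
  - assert (exists j, (j < k)%nat /\ G j = false) as (jn & hjn & Gn).
    { apply NNPP; intros N; apply K; intros j hj. destruct (G j) eqn:E; auto. exfalso; apply N; eauto. }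
    pose proof (hG jn hjn) as hjp; rewrite Gn in hjp.
    assert (hB : 0 < T - w M).
    { assert (jn <> M) by (intros ->; congruence).
      pose proof (sm_upd w k M 0 hM).
      assert (upd w M 0 jn <= sm (upd w M 0) k).
      { apply sm_term_le; auto. intros j hj; unfold upd; destruct (Nat.eqb j M); [lra|apply hw; auto]. }
      rewrite upd_neq in H1 by auto. fold T in H0. lra. }
    assert (hA : 0 < w M) by (pose proof (hw jn hjn); lra).
    destruct (Rle_or_lt T (2 * w M)) as [L|L].
    + set (g := fun j => if G j then O else 1%nat).
      assert (gA : gsum w g 1 0 0 k = w M).
      { rewrite <- (sm_indicator w k M hM). apply sm_ext; intros j hj. unfold pick, g.
        pose proof (hG j hj) as h. destruct (Nat.eqb_spec j M) as [->|E].
        - rewrite GM; simpl; ring.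
        - destruct (G j); simpl; [destruct h; [tauto|lra]|ring]. }
      pose proof (gsum_total w g k) as gT. fold T in gT.
      destruct (bar2_section w k g 1 ltac:(ring)) as (X & pX & X1 & X2 & _); try lra.
      rewrite gA in *. replace (gsum w g 0 1 0 k + gsum w g 0 0 1 k) with (T - w M) in * by lra.
      rewrite (Rabs_pos_eq (w M - (T - w M))) in * by lra.
      replace (w M - (T - w M)) with (2 * w M - T) in * by ring.
      replace (w M + (T - w M)) with T in * by ring.
      exists X; split; [|split].
      * rewrite Rmax_right by lra; exact pX.
      * auto.
      * intros _ j _. rewrite X2; unfold pick, g; now destruct (G j).
    + destruct (half_index w k (T / 2)) as (i & hi & h1 & h2); [fold T; lra|]. simpl in h2.
      set (g := around i).
      pose proof (hw i hi) as hwi.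
      assert (gA : gsum w g 1 0 0 k = w i) by (now apply gsum_around_eq).
      assert (gB : gsum w g 0 1 0 k = sm w i) by (unfold g; rewrite gsum_around_lt, Nat.min_r by lia; auto).
      pose proof (gsum_total w g k) as gT. fold T in gT.
      destruct (bar2_section w k g 1 ltac:(ring)) as (X & pX & X1 & X2 & _); try lra.
      destruct (bar3_section w k g 1 ltac:(ring)) as (Y & pY & Y1 & _); try lra.
      { intros; lra. }
      rewrite (Rabs_left1 (gsum w g 1 0 0 k - _)) in * by lra.
      assert (m0 : Rmax 0 (Rabs (gsum w g 0 1 0 k - gsum w g 0 0 1 k) - gsum w g 1 0 0 k) = 0).
      { apply Rmax_left. assert (Rabs (gsum w g 0 1 0 k - gsum w g 0 0 1 k) <= gsum w g 1 0 0 k); [|lra].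
        apply Rabs_le; lra. }
      rewrite m0 in pY.
      set (mid := gsum w g 0 1 0 k + gsum w g 0 0 1 k - gsum w g 1 0 0 k) in *.
      replace (- (gsum w g 1 0 0 k - (gsum w g 0 1 0 k + gsum w g 0 0 1 k))) with mid in * by (unfold mid; ring).
      replace (gsum w g 1 0 0 k + (gsum w g 0 1 0 k + gsum w g 0 0 1 k)) with T in * by lra.
      destruct (pth_glue w k (fun y => y) 0 mid T Y X) as (Z & pZ & ZY & ZX); auto.
      { unfold mid; lra. }
      { apply flip_rote; intros j hj; rewrite X2, Y1 by auto. unfold pick, east, west.
        destruct (Nat.eqb (g j) 0), (Nat.eqb (g j) 1); simpl; f_equal; ring. }
      destruct (ZX T) as (c & s & hcs & HZ); [unfold mid; lra|].
      (* This undoes the rotation introduced by gluing, so that the value at [T] is [east]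
         itself. *)
      exists (fun y j => rotp c (- s) (Z y j)); split; [split|split].
      * intros j hj; destruct pZ as [cZ _]; destruct (cZ j hj) as [c1 c2].
        unfold rotp; cbn [fst snd]; split; intros t; lims; auto.
      * intros y hy. apply over_rote with (Z y).
        -- exists c, (- s); split; auto. rewrite <- hcs; ring.
        -- apply pZ. rewrite Rmax_left in hy by lra. lra.
      * intros j hj. rewrite HZ, X1 by auto. unfold rotp, east; cbn [fst snd].
        f_equal; [transitivity (c ^ 2 + s ^ 2); [ring|exact hcs]|ring].
      * intros h; lra.
Qed.

(** * Bounds for the length *)

Lemma sm_dot w k z p :
  fst p * sx w k z + snd p * sy w k z = sm (fun j => w j * dot p (z j)) k.
Proof.
  unfold sx, sy. rewrite <- !sm_scal, <- sm_plus. apply sm_ext; intros; unfold dot; ring.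
Qed.

Lemma length_le_total w k z x : (forall j, (j < k)%nat -> 0 <= w j) -> 0 <= x ->
  over w k z x -> x <= sm w k.
Proof.
  intros hw hx [u o]. destruct (polar (sx w k z) (sy w k z)) as (h & n & hh & hn & e1 & e2).
  assert (h ^ 2 = x ^ 2).
  { rewrite <- o, e1, e2. unfold unitv in hn.
    transitivity (h ^ 2 * (fst n ^ 2 + snd n ^ 2)); [rewrite hn|]; ring. }
  assert (h = x) by nra. subst h.
  replace x with (fst n * sx w k z + snd n * sy w k z).
  - rewrite sm_dot. apply sm_le; intros j hj. pose proof (dot_bound n (z j) hn (u j hj)).
    pose proof (hw j hj). nra.
  - rewrite e1, e2. unfold unitv in hn. transitivity (x * (fst n ^ 2 + snd n ^ 2)); [|rewrite hn]; ring.
Qed.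

(** Project the sum onto the direction of bar [i]: this bar contributes [w i], each other bar [j] at
    least [- w j]. *)
Lemma length_ge_excess w k z x i : (forall j, (j < k)%nat -> 0 <= w j) -> 0 <= x ->
  over w k z x -> (i < k)%nat -> 2 * w i - sm w k <= x.
Proof.
  intros hw hx [u o] hi.
  assert (h1 : fst (z i) * sx w k z + snd (z i) * sy w k z <= x).
  { pose proof (u i hi) as ui; unfold unitv in ui.
    assert ((fst (z i) * sx w k z + snd (z i) * sy w k z) ^ 2 + (fst (z i) * sy w k z - snd (z i) * sx w k z) ^ 2
      = x ^ 2).
    { rewrite <- o. transitivity ((fst (z i) ^ 2 + snd (z i) ^ 2) * (sx w k z ^ 2 + sy w k z ^ 2));
        [|rewrite ui]; ring. }
    pose proof (pow2_ge_0 (fst (z i) * sy w k z - snd (z i) * sx w k z)). nra. }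
  eapply Rle_trans; [|exact h1]. rewrite sm_dot.
  replace (2 * w i - sm w k) with (sm (upd (fun j => -1 * w j) i (w i)) k).
  - apply sm_le; intros j hj. unfold upd; destruct (Nat.eqb_spec j i) as [->|].
    + pose proof (u i hi) as ui. unfold unitv, dot in *.
      replace (fst (z i) * fst (z i) + snd (z i) * snd (z i)) with 1 by (rewrite <- ui; ring). lra.
    + pose proof (dot_bound (z i) (z j) (u i hi) (u j hj)). pose proof (hw j hj). nra.
  - rewrite sm_upd, sm_scal by auto. ring.
Qed.

(** The middle section [Bs] has parallel [ia] and [ib] and so serves both signs; only the outer
    pieces depend on [ka]. Hence all resulting sections agree over [x]. *)
Lemma sheet_section_glue l k ia ib lo y1 x y2 hi Bs :
  (ia < k)%nat -> (ib < k)%nat -> lo <= y1 <= x -> x <= y2 <= hi ->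
  pth l k (fun y => y) y1 y2 Bs -> (forall y, y1 <= y <= y2 -> cr (Bs y ia) (Bs y ib) = 0) ->
  (forall ka, ka ^ 2 = 1 -> exists L, pth l k (fun y => y) lo y1 L /\
     (forall y, lo <= y <= y1 -> 0 <= ka * cr (L y ia) (L y ib)) /\ rote k (L y1) (Bs y1)) ->
  (forall ka, ka ^ 2 = 1 -> exists U, pth l k (fun y => y) y2 hi U /\
     (forall y, y2 <= y <= hi -> 0 <= ka * cr (U y ia) (U y ib)) /\ rote k (U y2) (Bs y2)) ->
  exists B, forall ka, ka ^ 2 = 1 -> exists X, pth l k (fun y => y) lo hi X /\
     (forall y, lo <= y <= hi -> 0 <= ka * cr (X y ia) (X y ib)) /\ rote k B (X x).
Proof.
  intros hia hib h1 h2 pB cB HL HU. exists (Bs x). intros ka hka.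
  destruct (HL ka hka) as (L & pL & cL & eL), (HU ka hka) as (U & pU & cU & eU).
  destruct (pth_glue l k (fun y => y) lo y1 y2 L Bs ltac:(lra) pL pB (rote_sym _ _ _ eL))
    as (Z & pZ & ZL & ZB).
  destruct (pth_glue l k (fun y => y) lo y2 hi Z U ltac:(lra) pZ pU) as (W & pW & WZ & WU).
  { eapply rote_trans; [exact eU|apply ZB; lra]. }
  exists W; split; [auto|split].
  - intros y hy. destruct (Rle_or_lt y y1) as [K|K]; [|destruct (Rle_or_lt y y2) as [K'|K'] ].
    + rewrite (rote_cr k (L y) (W y)) by (first [assumption | eapply rote_trans; [apply ZL|apply WZ]; lra]). apply cL; lra.
    + rewrite (rote_cr k (Bs y) (W y)) by (first [assumption | eapply rote_trans; [apply ZB|apply WZ]; lra]).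
      rewrite cB by lra. lra.
    + rewrite (rote_cr k (U y) (W y)) by (auto; apply WU; lra). apply cU; lra.
  - eapply rote_trans; [apply ZB|apply WZ]; lra.
Qed.

(** * Merging two parallel bars, and the sections this yields *)

Lemma upd_upd T (u : nat -> T) n v w : upd (upd u n v) n w = upd u n w.
Proof. apply functional_extensionality; intros j; unfold upd; now destruct (Nat.eqb j n). Qed.

(* Bars ia and ib replaced by one bar of length l ia + s * l ib, s = 1 or -1. *)
Definition merged l (ia ib : nat) s : nat -> R := upd (upd l ib 0) ia (l ia + s * l ib).
Definition unmerge (ia ib : nat) s (u : cfg) : cfg := upd u ib (s * fst (u ia), s * snd (u ia)).

Section Merged.
Variables (l : nat -> R) (k ia ib : nat) (s : R).
Hypotheses (hia : (ia < k)%nat) (hib : (ib < k)%nat) (hne : ia <> ib) (hs : s ^ 2 = 1).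

Lemma over_unmerge u y : over (merged l ia ib s) k u y -> over l k (unmerge ia ib s u) y.
Proof.
  intros [hu ho]; split.
  - intros j hj; unfold unmerge, upd; destruct (Nat.eqb_spec j ib); auto.
    pose proof (hu ia hia) as h; unfold unitv in *; cbn [fst snd].
    transitivity (s ^ 2 * (fst (u ia) ^ 2 + snd (u ia) ^ 2)); [|rewrite h, hs]; ring.
  - rewrite <- ho. unfold unmerge. rewrite sx_upd, sy_upd by auto.
    rewrite (sx_split (upd l ib 0) k u ia), (sy_split (upd l ib 0) k u ia),
      (sx_split (merged l ia ib s) k u ia), (sy_split (merged l ia ib s) k u ia) by auto.
    unfold merged. rewrite upd_upd, upd_eq, upd_neq by auto. cbn [fst snd]. ring.
Qed.

Lemma over_merge u y : u ib = (s * fst (u ia), s * snd (u ia)) ->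
  over l k u y -> over (merged l ia ib s) k u y.
Proof.
  intros e [hu ho]; split; auto.
  rewrite <- ho.
  rewrite (sx_split l k u ib), (sy_split l k u ib) by auto.
  rewrite (sx_split (upd l ib 0) k u ia), (sy_split (upd l ib 0) k u ia),
      (sx_split (merged l ia ib s) k u ia), (sy_split (merged l ia ib s) k u ia) by auto.
  unfold merged. rewrite upd_upd, upd_eq, upd_neq, e by auto. cbn [fst snd]. ring.
Qed.

Lemma pth_unmerge lo hi X : pth (merged l ia ib s) k (fun y => y) lo hi X ->
  pth l k (fun y => y) lo hi (fun y => unmerge ia ib s (X y)).
Proof.
  intros [cX oX]; split.
  - intros j hj. destruct (cX j hj) as [c1 c2], (cX ia hia) as [c3 c4].
    unfold unmerge, upd; destruct (Nat.eqb j ib); cbn [fst snd]; split; intros t; lims; auto.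
  - intros y hy; apply over_unmerge; auto.
Qed.

Lemma cr_unmerge u : cr (unmerge ia ib s u ia) (unmerge ia ib s u ib) = 0.
Proof. unfold unmerge; rewrite upd_eq, upd_neq by auto; unfold cr; cbn [fst snd]; ring. Qed.

Lemma sm_merged : sm (merged l ia ib s) k = sm l k - l ib + s * l ib.
Proof. unfold merged; rewrite !sm_upd by auto. rewrite upd_neq by auto. ring. Qed.

Lemma merged_ia : merged l ia ib s ia = l ia + s * l ib.
Proof. unfold merged; now rewrite upd_eq. Qed.

Lemma merged_ib : merged l ia ib s ib = 0.
Proof. unfold merged; rewrite upd_neq, upd_eq by auto; auto. Qed.

Lemma merged_other j : j <> ia -> j <> ib -> merged l ia ib s j = l j.
Proof. intros; unfold merged; rewrite !upd_neq by auto; auto. Qed.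
End Merged.

Lemma parallel_unit p q : unitv p -> unitv q -> cr p q = 0 ->
  q = (1 * fst p, 1 * snd p) \/ q = (-1 * fst p, -1 * snd p).
Proof.
  unfold unitv, cr; destruct p as [a b], q as [c d]; cbn [fst snd]; intros h1 h2 h3.
  set (t := a * c + b * d).
  assert (ht : t ^ 2 = 1).
  { replace 1 with ((a ^ 2 + b ^ 2) * (c ^ 2 + d ^ 2) - (a * d - b * c) ^ 2) by (rewrite h1, h2, h3; ring).
    unfold t; ring. }
  assert (hc : c = t * a).
  { transitivity (c * (a ^ 2 + b ^ 2) + b * (a * d - b * c)); [rewrite h1, h3; ring|unfold t; ring]. }
  assert (hd : d = t * b).
  { transitivity (d * (a ^ 2 + b ^ 2) - a * (a * d - b * c)); [rewrite h1, h3; ring|unfold t; ring]. }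
  assert (hp : t = 1 \/ t = -1).
  { destruct (Req_dec t 1); auto. right. assert ((t - 1) * (t + 1) = 0) by (ring_simplify; lra).
    apply Rmult_integral in H0; destruct H0; lra. }
  destruct hp as [E|E]; rewrite E in hc, hd; [left|right]; now rewrite hc, hd.
Qed.

Lemma argmax (f : nat -> R) (P : nat -> Prop) n : (exists j, (j < n)%nat /\ P j) ->
  exists M, (M < n)%nat /\ P M /\ forall j, (j < n)%nat -> P j -> f j <= f M.
Proof.
  induction n; intros (j & hj & hp); [lia|].
  destruct (classic (exists j, (j < n)%nat /\ P j)) as [H|H].
  - destruct (IHn H) as (M & h1 & h2 & h3).
    destruct (classic (P n /\ f M <= f n)) as [[a b]|N].
    + exists n; split; [lia|split; auto]. intros i hi hpi.
      destruct (Nat.eq_dec i n) as [->|]; [lra|]. pose proof (h3 i ltac:(lia) hpi); lra.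
    + exists M; split; [lia|split; auto]. intros i hi hpi.
      destruct (Nat.eq_dec i n) as [->|]; [|apply h3; auto; lia].
      destruct (Rle_or_lt (f n) (f M)); auto. exfalso; apply N; split; auto; lra.
  - assert (j = n). { destruct (Nat.eq_dec j n); auto. exfalso; apply H; exists j; split; auto; lia. }
    subst j. exists n; split; [lia|split; auto]. intros i hi hpi.
    destruct (Nat.eq_dec i n) as [->|]; [lra|]. exfalso; apply H; exists i; split; auto; lia.
Qed.

Section SheetSections.
Variables (l : nat -> R) (k ia ib : nat) (z : cfg) (x : R).
Hypotheses (hia : (ia < k)%nat) (hib : (ib < k)%nat) (hne : ia <> ib)
  (hl : forall j, (j < k)%nat -> 0 < l j) (hab : l ib <= l ia)
  (hr : forall j, (j < k)%nat -> j <> ia -> j <> ib -> l j <= l ib)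
  (hx : 0 <= x) (hz : over l k z x).

(** [T] and [lo] are the bounds given by [length_le_total] and, for the longest bar, by
    [length_ge_excess] together with nonnegativity. *)
Let T := sm l k.
Let lo := Rmax 0 (2 * l ia - T).

Lemma two_le_total : l ia + l ib <= T.
Proof.
  pose proof (sm_upd l k ia 0 hia).
  assert (upd l ia 0 ib <= sm (upd l ia 0) k).
  { apply sm_term_le; auto. intros j hj; unfold upd; destruct (Nat.eqb j ia); [lra|].
    pose proof (hl j hj); lra. }
  rewrite upd_neq in H0 by auto. unfold T; lra.
Qed.

Lemma merged_nonneg s : (s = 1 \/ s = -1) -> forall j, (j < k)%nat -> 0 <= merged l ia ib s j.
Proof.
  intros hs j hj. destruct (Nat.eq_dec j ia) as [->|]; [rewrite merged_ia; pose proof (hl ib hib); destruct hs; subst; lra|].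
  destruct (Nat.eq_dec j ib) as [->|]; [rewrite merged_ib; auto; lra|].
  rewrite merged_other by auto. pose proof (hl j hj); lra.
Qed.

Lemma gsum_single g c p q r i : (i < k)%nat ->
  (forall j, (j < k)%nat -> pick g p q r j = if Nat.eqb j i then c else 0) -> gsum l g p q r k = c * l i.
Proof.
  intros hi h. rewrite <- (sm_indicator l k i hi), <- sm_scal. apply sm_ext; intros j hj.
  rewrite h by auto. destruct (Nat.eqb j i); ring.
Qed.

Lemma gsum_nonneg g p q r : 0 <= p -> 0 <= q -> 0 <= r -> 0 <= gsum l g p q r k.
Proof.
  intros hp hq hr'. apply sm_ge0; intros j hj. apply Rmult_le_pos; [left; auto|].
  unfold pick; now destruct (Nat.eqb (g j) 0), (Nat.eqb (g j) 1).
Qed.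

Lemma gsum_class0_pos g j : (j < k)%nat -> g j = O -> 0 < gsum l g 1 0 0 k.
Proof.
  intros hj e. apply Rlt_le_trans with (l j * pick g 1 0 0 j).
  - unfold pick; rewrite e; simpl. pose proof (hl j hj); lra.
  - apply (sm_term_le (fun j => l j * pick g 1 0 0 j)); auto. intros i hi. apply Rmult_le_pos; [left; auto|].
    unfold pick; destruct (Nat.eqb (g i) 0), (Nat.eqb (g i) 1); lra.
Qed.

Let two (i j n : nat) : nat := if Nat.eqb n i then 1%nat else if Nat.eqb n j then 2%nat else O.

(** [bar3_section] with [i] and [j] as classes 1 and 2 and all other bars as class 0; at [y1] these
    two are stretched against the rest. The last clause controls the orientation when only one of
    [ia], [ib] is singled out. *)
Lemma two_bars_section ka i j : ka ^ 2 = 1 -> (i < k)%nat -> (j < k)%nat -> i <> j ->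
  let y1 := 2 * l i + 2 * l j - T in 0 <= y1 -> exists X,
  pth l k (fun y => y) (Rmax 0 (2 * Rmax (l i) (l j) - T)) y1 X /\
  (forall n, (n < k)%nat -> X y1 n = if Nat.eqb n i then east else if Nat.eqb n j then east else west) /\
  (forall y, Rmax 0 (2 * Rmax (l i) (l j) - T) <= y <= y1 -> 0 <= ka * cr (X y i) (X y j)) /\
  (forall y n, Rmax 0 (2 * Rmax (l i) (l j) - T) <= y <= y1 -> (n < k)%nat -> n <> i -> n <> j ->
     0 <= ka * cr (X y n) (X y i)).
Proof.
  intros hka hi hj hij y1 hy1. assert (hy1' : 0 <= 2 * l i + 2 * l j - T) by exact hy1. set (g := two i j).
  assert (gB : gsum l g 0 1 0 k = l i).
  { rewrite (gsum_single g 1 0 1 0 i); auto; [ring|]. intros n hn; unfold pick, g, two.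
    destruct (Nat.eqb_spec n i); simpl; auto. destruct (Nat.eqb n j); auto. }
  assert (gC : gsum l g 0 0 1 k = l j).
  { rewrite (gsum_single g 1 0 0 1 j); auto; [ring|]. intros n hn; unfold pick, g, two.
    destruct (Nat.eqb_spec n i); subst; simpl; [destruct (Nat.eqb_spec i j); tauto|]. now destruct (Nat.eqb n j). }
  pose proof (gsum_total l g k) as gT. fold T in gT.
  pose proof (gsum_nonneg g 1 0 0 ltac:(lra) ltac:(lra) ltac:(lra)) as gA.
  pose proof (hl i hi); pose proof (hl j hj).
  destruct (bar3_section l k g ka hka) as (X & pX & X1 & X2 & X3); try lra.
  { intros n hn e; eapply gsum_class0_pos; eauto. }
  replace (gsum l g 0 1 0 k + gsum l g 0 0 1 k - gsum l g 1 0 0 k) with y1 in * by (unfold y1; lra).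
  replace (Rabs (gsum l g 0 1 0 k - gsum l g 0 0 1 k) - gsum l g 1 0 0 k) with
    (2 * Rmax (l i) (l j) - T) in * by (rewrite Rmax_abs, gB, gC; lra).
  assert (gi : g i = 1%nat) by (unfold g, two; now rewrite Nat.eqb_refl).
  assert (gj : g j = 2%nat) by (unfold g, two; destruct (Nat.eqb_spec j i); [subst; tauto|now rewrite Nat.eqb_refl]).
  exists X; split; [exact pX|split; [|split]].
  - intros n hn. rewrite X1 by auto. unfold pick, g, two. destruct (Nat.eqb n i); auto. now destruct (Nat.eqb n j).
  - intros y hy; apply X2; auto.
  - intros y n hy hn n1 n2. apply X3; auto. unfold g, two.
    destruct (Nat.eqb_spec n i); [tauto|]. destruct (Nat.eqb_spec n j); tauto.
Qed.

(** The point [z] shows that [x] is a length of the linkage with a bar of length [l ia + l ib]. A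
    section of that linkage reaches up to [T]; below its least length [y1], the triangle of bars
    [ia], [ib] and the rest continues down to [lo] in either orientation. *)
Lemma sheet_sections_straight : z ib = (1 * fst (z ia), 1 * snd (z ia)) ->
  exists B, forall ka, ka ^ 2 = 1 -> exists X, pth l k (fun y => y) lo T X /\
     (forall y, lo <= y <= T -> 0 <= ka * cr (X y ia) (X y ib)) /\ rote k B (X x).
Proof.
  intros e. set (m := merged l ia ib 1).
  assert (hs : 1 ^ 2 = 1) by ring.
  pose proof (merged_nonneg 1 (or_introl eq_refl)) as mp. fold m in mp.
  pose proof (over_merge l k ia ib 1 hia hib hne z x e hz) as oz. fold m in oz.
  assert (smT : sm m k = T) by (unfold m; rewrite sm_merged by auto; unfold T; ring).
  pose proof (length_le_total m k z x mp hx oz) as x2. rewrite smT in x2.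
  pose proof (length_ge_excess m k z x ia mp hx oz hia) as x1. rewrite smT in x1.
  assert (mia : m ia = l ia + l ib) by (unfold m; rewrite merged_ia; ring).
  pose proof (hl ib hib) as hlb. pose proof two_le_total as h2.
  set (G := fun j => orb (Nat.eqb j ia) (Nat.eqb j ib)).
  destruct (linkage_section m k ia G) as (X & pX & X1 & X2); auto.
  { intros j hj; split; [now apply mp|]. rewrite mia.
    destruct (Nat.eq_dec j ia) as [->|]; [lra|].
    destruct (Nat.eq_dec j ib) as [->|]; [unfold m; rewrite merged_ib; auto; lra|].
    unfold m; rewrite merged_other by auto. pose proof (hr j hj n n0); lra. }
  { unfold G; now rewrite Nat.eqb_refl. }
  { intros j hj; unfold G. destruct (Nat.eqb_spec j ia), (Nat.eqb_spec j ib); simpl; auto.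
    - right; subst j; unfold m; now apply merged_ib.
    - unfold m; rewrite merged_other by auto; auto. }
  rewrite smT in *. rewrite mia in *.
  set (y1 := Rmax 0 (2 * (l ia + l ib) - T)) in *.
  assert (y1x : y1 <= x) by (now apply Rmax_lub).
  assert (loy : lo <= y1).
  { unfold lo, y1. apply Rmax_lub; [apply Rmax_l|]. eapply Rle_trans; [|apply Rmax_r]. lra. }
  set (Bs := fun y => unmerge ia ib 1 (X y)).
  assert (pB : pth l k (fun y => y) y1 T Bs) by (now apply pth_unmerge).
  apply (sheet_section_glue l k ia ib lo y1 x T T Bs); auto; try lra.
  - intros y _. now apply cr_unmerge.
  - intros ka hka. destruct (Rle_or_lt (2 * (l ia + l ib) - T) 0) as [K|K].
    + assert (y1 = 0) by (unfold y1; now apply Rmax_left).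
      assert (0 <= lo) by apply Rmax_l.
      exists Bs; split; [apply pth_sub with y1 T; auto; lra|split; [|apply rote_refl]].
      intros y hy. unfold Bs; rewrite cr_unmerge by auto. lra.
    + assert (Ey : y1 = 2 * l ia + 2 * l ib - T) by (unfold y1; rewrite Rmax_right; lra).
      destruct (two_bars_section ka ia ib hka hia hib hne ltac:(lra)) as (L & pL & L1 & L2 & _).
      rewrite (Rmax_left (l ia) (l ib)) in pL, L2 by auto. rewrite <- Ey in *. fold lo in pL, L2.
      exists L; split; [auto|split; [auto|]].
      apply rote_eq; intros j hj. rewrite L1 by auto. unfold Bs, unmerge.
      replace y1 with (2 * (l ia + l ib) - T) by lra.
      unfold upd. destruct (Nat.eqb_spec j ib).
      * rewrite X2 by auto. unfold G; rewrite Nat.eqb_refl; simpl.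
        destruct (Nat.eqb_spec j ia); unfold east; simpl; f_equal; ring.
      * rewrite X2 by auto. unfold G. destruct (Nat.eqb_spec j ia); simpl; auto.
        destruct (Nat.eqb_spec j ib); tauto.
  - intros ka hka. exists Bs; split; [apply pth_sub with y1 T; auto; lra|split; [|apply rote_refl]].
    intros y hy. unfold Bs; rewrite cr_unmerge by auto. lra.
Qed.

(** The merged bar has length [l ia - l ib], so the middle section covers only [[y1, y2]] with
    [y2 = T - 2 * l ib]. Above [y2] bar [ib] unfolds against the others. Below [y1] something is
    missing only if a bar [M] other than the merged one is longest there; then [M] and one of [ia],
    [ib] form a triangle with the rest. *)
Lemma sheet_sections_folded : z ib = (-1 * fst (z ia), -1 * snd (z ia)) ->
  exists B, forall ka, ka ^ 2 = 1 -> exists X, pth l k (fun y => y) lo T X /\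
     (forall y, lo <= y <= T -> 0 <= ka * cr (X y ia) (X y ib)) /\ rote k B (X x).
Proof.
  intros e. set (m := merged l ia ib (-1)).
  assert (hs : (-1) ^ 2 = 1) by ring.
  pose proof (merged_nonneg (-1) (or_intror eq_refl)) as mp. fold m in mp.
  pose proof (over_merge l k ia ib (-1) hia hib hne z x e hz) as oz. fold m in oz.
  assert (smT : sm m k = T - 2 * l ib) by (unfold m; rewrite sm_merged by auto; unfold T; ring).
  pose proof (length_le_total m k z x mp hx oz) as x2. rewrite smT in x2.
  assert (mia : m ia = l ia - l ib) by (unfold m; rewrite merged_ia; ring).
  assert (mib : m ib = 0) by (unfold m; now apply merged_ib).
  assert (mot : forall j, j <> ia -> j <> ib -> m j = l j) by (intros; unfold m; now apply merged_other).
  pose proof (hl ib hib) as hlb. pose proof two_le_total as h2.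
  (* If l ia = l ib the merged bar is weightless and is made to follow the longest remaining bar. *)
  assert (HM : exists M i2 G, (M < k)%nat /\ (forall j, (j < k)%nat -> m j <= m M) /\ G M = true /\
    (forall j, (j < k)%nat -> if G j : bool then j = M \/ m j = 0 else 0 < m j) /\
    (M = ia \/ (M <> ia /\ M <> ib /\ l i2 = l ib /\
      ((i2 = ib /\ G ia = false) \/ (i2 = ia /\ G ia = true)) /\
      (forall j, j <> ia -> j <> ib -> j <> M -> G j = false)))).
  { destruct (classic (l ia = l ib /\ exists j, (j < k)%nat /\ (j <> ia /\ j <> ib))) as [[E H]|H].
    - destruct (argmax m _ k H) as (M & hM & (M1 & M2) & h).
      exists M, ia, (fun j => orb (Nat.eqb j M) (orb (Nat.eqb j ia) (Nat.eqb j ib))).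
      split; auto. split; [|split; [|split]].
      + intros j hj. pose proof (mp M hM). destruct (Nat.eq_dec j ia) as [->|]; [lra|].
        destruct (Nat.eq_dec j ib) as [->|]; [lra|auto].
      + now rewrite Nat.eqb_refl.
      + intros j hj. destruct (Nat.eqb_spec j M), (Nat.eqb_spec j ia), (Nat.eqb_spec j ib); simpl; auto;
          try (right; subst j; lra). rewrite mot by auto; auto.
      + right. repeat split; auto.
        * right; split; auto. rewrite Nat.eqb_refl; simpl. apply Bool.orb_true_r.
        * intros j n1 n2 n3. apply Nat.eqb_neq in n1, n2, n3. now rewrite n1, n2, n3.
    - destruct (argmax m (fun j => j <> ib) k) as (M & hM & M1 & h); [now exists ia|].
      exists M, ib, (fun j => orb (Nat.eqb j M) (Nat.eqb j ib)).
      split; auto. split; [|split; [|split]].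
      + intros j hj. pose proof (mp M hM). destruct (Nat.eq_dec j ib) as [->|]; [lra|auto].
      + now rewrite Nat.eqb_refl.
      + intros j hj. destruct (Nat.eqb_spec j M), (Nat.eqb_spec j ib); simpl; auto; try (right; subst j; lra).
        destruct (Nat.eq_dec j ia) as [->|]; [|rewrite mot by auto; auto].
        rewrite mia. destruct (Req_dec (l ia) (l ib)) as [E|]; [|lra].
        exfalso; apply H; split; auto. exists M; auto.
      + destruct (Nat.eq_dec M ia) as [|n]; [now left|right]. repeat split; auto.
        * left; split; auto. apply Nat.eqb_neq in n, hne. rewrite Nat.eqb_sym, n, hne; auto.
        * intros j n1 n2 n3. apply Nat.eqb_neq in n2, n3. now rewrite n2, n3. }
  destruct HM as (M & i2 & G & hM & mmax & GM & hG & HM).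
  destruct (linkage_section m k M G) as (X & pX & X1 & X2); auto.
  pose proof (length_ge_excess m k z x M mp hx oz hM) as x1.
  pose proof (mmax ia hia) as miaM.
  rewrite smT in *.
  set (y1 := Rmax 0 (2 * m M - (T - 2 * l ib))) in *.
  set (y2 := T - 2 * l ib) in *.
  assert (y1x : y1 <= x) by (now apply Rmax_lub).
  assert (loy : lo <= y1).
  { unfold lo, y1, y2. apply Rmax_lub; [apply Rmax_l|]. eapply Rle_trans; [|apply Rmax_r]. lra. }
  assert (lo0 : 0 <= lo) by apply Rmax_l.
  set (Bs := fun y => unmerge ia ib (-1) (X y)).
  assert (pB : pth l k (fun y => y) y1 y2 Bs) by (now apply pth_unmerge).
  assert (triv : lo = y1 -> forall ka : R, ka ^ 2 = 1 -> exists L, pth l k (fun y => y) lo y1 L /\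
     (forall y, lo <= y <= y1 -> 0 <= ka * cr (L y ia) (L y ib)) /\ rote k (L y1) (Bs y1)).
  { intros E ka _. exists Bs; split; [apply pth_sub with y1 y2; auto; lra|split; [|apply rote_refl]].
    intros y hy. unfold Bs; rewrite cr_unmerge by auto. lra. }
  apply (sheet_section_glue l k ia ib lo y1 x y2 T Bs); auto; try (unfold y2 in *; lra).
  - intros y _. now apply cr_unmerge.
  - destruct (Rle_or_lt (2 * m M - y2) 0) as [K|K].
    { apply triv. assert (y1 = 0) by (unfold y1; now apply Rmax_left). lra. }
    assert (Ey : y1 = 2 * m M - y2) by (unfold y1; rewrite Rmax_right; lra).
    destruct HM as [->|(M1 & M2 & e2 & HG & Goth)].
    (* If the merged bar is longest, [y1] is 2 (l ia - l ib) - (T - 2 l ib) = 2 l ia - T, already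
       the lower end. *)
    { apply triv. rewrite Ey, mia. unfold lo, y2 in *. rewrite Rmax_right; lra. }
    rewrite mot in * by auto.
    pose proof (hr M hM M1 M2) as hMb.
    assert (h2k : (i2 < k)%nat) by (destruct HG as [[-> _]|[-> _]]; auto).
    assert (h2M : i2 <> M) by (destruct HG as [[-> _]|[-> _]]; auto).
    intros ka hka.
    (* Only the orientation of a rest bar relative to [i2] is controlled; for [i2 = ia] that rest
       bar is [ib], and exchanging the arguments of [cr] changes the sign. *)
    set (kb := if Nat.eqb i2 ib then ka else - ka).
    assert (hkb : kb ^ 2 = 1) by (unfold kb; destruct (Nat.eqb i2 ib); [auto|rewrite <- hka; ring]).
    unfold y2 in Ey, K.
    destruct (two_bars_section kb i2 M hkb h2k hM h2M ltac:(lra)) as (L & pL & L1 & _ & L2).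
    replace (2 * l i2 + 2 * l M - T) with y1 in * by lra.
    (* Here [l M <= l i2 = l ib], and 2 l ib <= l ia + l ib <= T, so the triangle reaches down to
       length 0. *)
    assert (l0 : Rmax 0 (2 * Rmax (l i2) (l M) - T) = 0).
    { apply Rmax_left. rewrite (Rmax_left (l i2)) by lra. lra. }
    rewrite l0 in *.
    exists L; split; [apply pth_sub with 0 y1; auto; lra|split].
    + intros y hy. destruct HG as [[E _]|[E _]]; subst i2; unfold kb in L2.
      * rewrite Nat.eqb_refl in L2. apply L2; auto; lra.
      * rewrite (proj2 (Nat.eqb_neq ia ib) hne) in L2.
        specialize (L2 y ib ltac:(lra) hib ltac:(auto) ltac:(auto)).
        unfold cr in *; lra.
    + apply rote_eq; intros j hj. rewrite L1 by auto. unfold Bs, unmerge.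
      rewrite Ey. fold y2. fold y2 in K. unfold upd.
      destruct (Nat.eqb_spec j ib) as [->|].
      * rewrite X2 by auto. destruct HG as [[E F]|[E F]]; subst i2; rewrite F.
        -- rewrite Nat.eqb_refl. unfold east, west; cbn [fst snd]; f_equal; ring.
        -- rewrite (proj2 (Nat.eqb_neq ib ia)), (proj2 (Nat.eqb_neq ib M)) by auto.
           unfold east, west; cbn [fst snd]; f_equal; ring.
      * rewrite X2 by auto. destruct (Nat.eqb_spec j M) as [->|].
        -- rewrite GM. now destruct (Nat.eqb M i2).
        -- destruct (Nat.eq_dec j ia) as [->|].
           ++ destruct HG as [[E F]|[E F]]; subst i2; rewrite F.
              ** now rewrite (proj2 (Nat.eqb_neq ia ib)) by auto.
              ** now rewrite Nat.eqb_refl.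
           ++ rewrite Goth by auto. destruct HG as [[E F]|[E F]]; subst i2.
              ** now rewrite (proj2 (Nat.eqb_neq j ib)) by auto.
              ** now rewrite (proj2 (Nat.eqb_neq j ia)) by auto.
  - intros ka hka.
    (* All bars except [ib] form one rigid bar, against which [ib] swings from folded to aligned. *)
    set (g := fun j => if Nat.eqb j ib then 1%nat else O).
    assert (gB : gsum l g 0 1 0 k = l ib).
    { rewrite (gsum_single g 1 0 1 0 ib); auto; [ring|]. intros n hn; unfold pick, g.
      now destruct (Nat.eqb n ib). }
    assert (gC : gsum l g 0 0 1 k = 0).
    { rewrite (gsum_single g 0 0 0 1 ib); auto; [ring|]. intros n hn; unfold pick, g.
      now destruct (Nat.eqb n ib). }
    pose proof (gsum_total l g k) as gT. fold T in gT. pose proof (hl ia hia).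
    destruct (bar2_section l k g ka hka) as (U & pU & _ & U1 & U2); try lra.
    rewrite gB, gC in *. replace (gsum l g 1 0 0 k) with (T - l ib) in * by lra.
    rewrite (Rabs_pos_eq (T - l ib - _)) in * by lra.
    replace (T - l ib - (l ib + 0)) with y2 in * by (unfold y2; ring).
    replace (T - l ib + (l ib + 0)) with T in * by ring.
    exists U; split; [auto|split].
    + intros y hy; apply U2; auto; unfold g.
      * now rewrite (proj2 (Nat.eqb_neq ia ib)).
      * rewrite Nat.eqb_refl; discriminate.
    + apply rote_eq; intros j hj. rewrite U1. unfold Bs, unmerge, pick, g, upd.
      destruct (Nat.eqb_spec j ib); simpl Nat.eqb; cbv iota; rewrite X1 by auto; [|auto].
      unfold east, west; cbn [fst snd]; f_equal; ring.
Qed.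

(* B is the common point over x of the two sections obtained for ka = 1 and ka = -1. *)
Lemma sheet_sections : cr (z ia) (z ib) = 0 ->
  exists B, forall ka, ka ^ 2 = 1 -> exists X, pth l k (fun y => y) lo T X /\
     (forall y, lo <= y <= T -> 0 <= ka * cr (X y ia) (X y ib)) /\ rote k B (X x).
Proof.
  intros hc. destruct hz as [hu _].
  destruct (parallel_unit _ _ (hu ia hia) (hu ib hib) hc);
    [now apply sheet_sections_straight|now apply sheet_sections_folded].
Qed.
End SheetSections.

(** * Lifting along a section *)

Definition rotc c s (u : cfg) : cfg := fun j => rotp c s (u j).

Lemma rote_rotc k c s u : c ^ 2 + s ^ 2 = 1 -> rote k u (rotc c s u).
Proof. intros h; exists c, s; split; auto. Qed.

Lemma pth_rotc l k al lo hi X c s : c ^ 2 + s ^ 2 = 1 -> pth l k al lo hi X ->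
  pth l k al lo hi (fun t => rotc c s (X t)).
Proof.
  intros h [cX oX]; split.
  - intros j hj; destruct (cX j hj). unfold rotc, rotp; cbn [fst snd]; split; intros t; lims; auto.
  - intros t ht. eapply over_rote; [now apply rote_rotc|auto].
Qed.

Lemma normalize l k u y : 0 < y -> over l k u y ->
  exists c s, c ^ 2 + s ^ 2 = 1 /\ fibre l k y (rotc c s u).
Proof.
  intros hy [hu ho]. set (c := sx l k u / y). set (s := - sy l k u / y).
  assert (h : c ^ 2 + s ^ 2 = 1).
  { transitivity ((sx l k u ^ 2 + sy l k u ^ 2) / y ^ 2); [unfold c, s; field; lra|rewrite ho; field; lra]. }
  exists c, s; split; auto. split; [|split].
  - intros j hj; now apply unitv_rotp, hu.
  - rewrite (sx_rotp l k u (rotc c s u) c s) by auto.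
    transitivity ((sx l k u ^ 2 + sy l k u ^ 2) / y); [unfold c, s; field; lra|rewrite ho; field; lra].
  - rewrite (sy_rotp l k u (rotc c s u) c s) by auto. unfold c, s; field; lra.
Qed.

Lemma fibre_over l k y u : fibre l k y u -> over l k u y.
Proof. intros (h1 & h2 & h3); split; auto. rewrite h2, h3; ring. Qed.

Lemma lift_rote l k al t1 u1 t2 u2 v1 v2 : rote k v1 u1 -> rote k v2 u2 ->
  lift l k al t1 u1 t2 u2 -> lift l k al t1 v1 t2 v2.
Proof.
  intros h1 h2 (X & pX & e1 & e2); exists X; split; auto; split; eapply rote_trans; eauto.
Qed.

(** For small [t] the value of the section at [al t] is close to its value at [al 0], hence an
    admissible target of [quick]. *)
Lemma quick_section l k al p lo hi X : cont al ->
  (forall t, 0 <= t <= 1 -> lo <= al t <= hi) -> pth l k (fun y => y) lo hi X ->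
  quick l k al p (X (al 0)) ->
  forall d, 0 < d -> exists t, 0 < t < d /\ lift l k al 0 p t (X (al t)).
Proof.
  intros hal hr pX (e & he & H) d hd.
  assert (K : at_ 0 (fun t => near k (X (al 0)) (X (al t)) e)).
  { apply (filt_forall_lt _ _ (fun j t => Rabs (fst (X (al t) j) - fst (X (al 0) j)) < e /\
       Rabs (snd (X (al t) j) - snd (X (al 0) j)) < e)); auto using filt_at.
    intros j hj. destruct pX as [cX _]; destruct (cX j hj) as [c1 c2].
    apply (proj1 (proj2 (filt_at 0))).
    - exact (cont_comp _ _ hal c1 0 e he).
    - exact (cont_comp _ _ hal c2 0 e he). }
  destruct K as (r & hr0 & K).
  set (m := Rmin (Rmin d e) (Rmin r 1)).
  assert (hm : 0 < m) by (repeat apply Rmin_glb_lt; lra).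
  assert (m <= d /\ m <= e /\ m <= r /\ m <= 1) as (m1 & m2 & m3 & m4).
  { unfold m. pose proof (Rmin_l (Rmin d e) (Rmin r 1)); pose proof (Rmin_r (Rmin d e) (Rmin r 1)).
    pose proof (Rmin_l d e); pose proof (Rmin_r d e); pose proof (Rmin_l r 1); pose proof (Rmin_r r 1). lra. }
  exists (m / 2); split; [lra|]. apply H; [|lra|].
  - apply K. apply Rabs_def1; lra.
  - apply pX. apply hr; lra.
Qed.

Lemma quick_agree l k al p u v : (forall j, (j < k)%nat -> v j = u j) ->
  quick l k al p u -> quick l k al p v.
Proof.
  intros E (e & he & H). exists e; split; auto. intros m t hm. apply H.
  intros j hj. rewrite <- E by auto. now apply hm.
Qed.

Section Start.
Variables (l : nat -> R) (k ia ib : nat) (al : R -> R) (p : cfg).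
Hypotheses (hia : (ia < k)%nat) (hib : (ib < k)%nat) (hne : ia <> ib)
  (hl : forall j, (j < k)%nat -> 0 < l j) (hab : l ib <= l ia)
  (hr : forall j, (j < k)%nat -> j <> ia -> j <> ib -> l j <= l ib)
  (hal : cont al) (hp : over l k p (al 0)) (hpos : 0 < al 0)
  (htr : forall z, over l k z (al 0) -> transverse l k z).

(** [X] lies in the sheet of [p], so [quick] spreads from [p] to its value over [al 0]. The target
    section [Y] only has to meet [X] there; it may continue in the other sheet, as is needed when
    sheets are changed at an end of the path. *)
Lemma start_lift ka lo hi X Y : ka ^ 2 = 1 -> 0 <= ka * cr (p ia) (p ib) ->
  (forall t, 0 <= t <= 1 -> lo <= al t <= hi) ->
  pth l k (fun y => y) lo hi X -> (forall y, lo <= y <= hi -> 0 <= ka * cr (X y ia) (X y ib)) ->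
  pth l k (fun y => y) lo hi Y -> rote k (X (al 0)) (Y (al 0)) ->
  forall d, 0 < d -> exists t, 0 < t < d /\ lift l k al 0 p t (Y (al t)).
Proof.
  intros hka hc hrange pX cX pY eXY d hd.
  assert (h0 : lo <= al 0 <= hi) by (apply hrange; lra).
  destruct (normalize l k p (al 0) hpos hp) as (c & s & hcs & fp).
  destruct (normalize l k (X (al 0)) (al 0) hpos) as (c' & s' & hcs' & fX); [now apply pX|].
  set (p' := rotc c s p) in *. set (x' := rotc c' s' (X (al 0))) in *.
  assert (qp : quick l k al p' p').
  { apply quick_self; auto; [now apply fibre_over|]. now apply htr, fibre_over. }
  assert (LC : locally_constant k (fibre l k (al 0)) (quick l k al p')).
  { intros u fu. destruct (quick_locally_constant l k al p' hl hal htr u (fibre_over _ _ _ _ fu)) as (e & he & H).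
    exists e; split; auto. intros u' fu'. apply H. now apply fibre_over. }
  assert (qx : quick l k al p' x').
  { apply (sheet_connected l k ia ib (al 0) ka hia hib hne hl hab hr hka _ LC p' x'); auto.
    - rewrite (rote_cr k p p') by (auto; now apply rote_rotc); auto.
    - rewrite (rote_cr k (X (al 0)) x') by (auto; now apply rote_rotc). now apply cX. }
  assert (rY : rote k (Y (al 0)) x').
  { eapply rote_trans; [apply rote_sym; exact eXY|now apply rote_rotc]. }
  destruct rY as (c2 & s2 & hcs2 & E).
  destruct (quick_section l k al p' lo hi (fun y => rotc c2 s2 (Y y)) hal hrange
    (pth_rotc _ _ _ _ _ _ _ _ hcs2 pY)) with d as (t & ht & L); auto.
  { apply quick_agree with x'; auto. intros j hj; now rewrite E. }
  exists t; split; auto. eapply lift_rote; [| |exact L]; now apply rote_rotc.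
Qed.
End Start.

Lemma lift_along_section l k al lo hi t1 t2 X : cont al -> t1 <= t2 ->
  (forall t, t1 <= t <= t2 -> lo <= al t <= hi) -> pth l k (fun y => y) lo hi X ->
  lift l k al t1 (X (al t1)) t2 (X (al t2)).
Proof.
  intros hal ht hr pX. exists (fun t => X (al t)); split; [|split; apply rote_refl].
  now apply pth_compose with lo hi.
Qed.

(** * Placements *)

Definition ev (l : nat -> R) (p : placement) : cfg :=
  fun j => ((fst (p (S j)) - fst (p j)) / l j, (snd (p (S j)) - snd (p j)) / l j).

Definition pl (l : nat -> R) (u : cfg) : placement := fun i => (sx l i u, sy l i u).

Lemma sx_ev l k p : (forall j, (j < k)%nat -> 0 < l j) -> forall i, (i <= k)%nat ->
  sx l i (ev l p) = fst (p i) - fst (p O).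
Proof.
  intros hl; induction i; intros hi; [unfold sx; simpl; ring|].
  change (sx l (S i) (ev l p)) with (sx l i (ev l p) + l i * fst (ev l p i)).
  rewrite IHi by lia. unfold ev; cbn [fst]. pose proof (hl i ltac:(lia)). field; lra.
Qed.

Lemma sy_ev l k p : (forall j, (j < k)%nat -> 0 < l j) -> forall i, (i <= k)%nat ->
  sy l i (ev l p) = snd (p i) - snd (p O).
Proof.
  intros hl; induction i; intros hi; [unfold sy; simpl; ring|].
  change (sy l (S i) (ev l p)) with (sy l i (ev l p) + l i * snd (ev l p i)).
  rewrite IHi by lia. unfold ev; cbn [snd]. pose proof (hl i ltac:(lia)). field; lra.
Qed.

Lemma dist_sq a b : Defs.dist a b ^ 2 = (fst a - fst b) ^ 2 + (snd a - snd b) ^ 2.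
Proof. unfold Defs.dist. apply pow2_sqrt. apply Rplus_le_le_0_compat; apply pow2_ge_0. Qed.

Lemma dist_ge0 a b : 0 <= Defs.dist a b.
Proof. apply sqrt_pos. Qed.

Lemma over_ev l k p : (forall j, (j < k)%nat -> 0 < l j) -> inC k l p -> over l k (ev l p) (theta k p).
Proof.
  intros hl hp; split.
  - intros j hj. pose proof (hl j hj). pose proof (dist_sq (p j) (p (S j))) as h. rewrite hp in h by auto.
    unfold unitv, ev; cbn [fst snd].
    transitivity (((fst (p j) - fst (p (S j))) ^ 2 + (snd (p j) - snd (p (S j))) ^ 2) / l j ^ 2);
      [field; lra|rewrite <- h; field; lra].
  - rewrite (sx_ev l k), (sy_ev l k) by auto. unfold theta; rewrite dist_sq. ring.
Qed.

Lemma inC_pl l k u : (forall j, (j < k)%nat -> 0 < l j) -> unitc k u -> inC k l (pl l u).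
Proof.
  intros hl hu j hj. pose proof (hl j hj). unfold Defs.dist, pl; cbn [fst snd].
  change (sx l (S j) u) with (sx l j u + l j * fst (u j)).
  change (sy l (S j) u) with (sy l j u + l j * snd (u j)).
  rewrite <- (sqrt_pow2 (l j)) at 3 by lra. f_equal.
  pose proof (hu j hj) as h; unfold unitv in h.
  transitivity (l j ^ 2 * (fst (u j) ^ 2 + snd (u j) ^ 2)); [ring|rewrite h; ring].
Qed.

Lemma theta_pl l k u y : 0 <= y -> over l k u y -> theta k (pl l u) = y.
Proof.
  intros hy [_ ho]. unfold theta, Defs.dist, pl; cbn [fst snd].
  rewrite <- (sqrt_pow2 y) by auto. f_equal. rewrite <- ho. unfold sx at 1, sy at 1; simpl sm. ring.
Qed.

Lemma congr_pl l k p v : (forall j, (j < k)%nat -> 0 < l j) -> rote k (ev l p) v -> congr k p (pl l v).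
Proof.
  intros hl (c & s & hcs & H).
  exists c, s, (- (c * fst (p O) - s * snd (p O))), (- (s * fst (p O) + c * snd (p O))); split; auto.
  intros i hi. unfold pl, or_isom.
  rewrite (sx_rotp l i (ev l p) v c s), (sy_rotp l i (ev l p) v c s) by (intros; apply H; lia).
  rewrite (sx_ev l k p hl i hi), (sy_ev l k p hl i hi). f_equal; ring.
Qed.

(** Not divided by the length, so that cross products are polynomial in the placement. *)
Definition ed (p : placement) j : R * R := (fst (p (S j)) - fst (p j), snd (p (S j)) - snd (p j)).

Lemma openM_cr k l i j ka : (i < k)%nat -> (j < k)%nat ->
  openM k l (fun p => 0 < ka * cr (ed p i) (ed p j)).
Proof.
  intros hi hj; split.
  - intros p q _ (c & s & u & w & hcs & H) hU.
    replace (cr (ed q i) (ed q j)) with (cr (ed p i) (ed p j)); auto.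
    rewrite <- (cr_rotp c s (ed p i)) by auto.
    unfold ed; rewrite !H by lia. unfold cr, rotp, or_isom; cbn [fst snd]. ring.
  - intros p _ hU. cbv beta in hU.
    assert (hF := filt_nhds (S k) p 0).
    assert (L : nhds (S k) p 0 (fun q => 0 < ka * cr (ed (fst q) i) (ed (fst q) j))).
    { apply (lim_ev_gt _ _ _ (ka * cr (ed p i) (ed p j))); auto.
      pose proof (lim_nhds_fst (S k) p 0 i ltac:(lia)); pose proof (lim_nhds_snd (S k) p 0 i ltac:(lia)).
      pose proof (lim_nhds_fst (S k) p 0 j ltac:(lia)); pose proof (lim_nhds_snd (S k) p 0 j ltac:(lia)).
      pose proof (lim_nhds_fst (S k) p 0 (S i) ltac:(lia)); pose proof (lim_nhds_snd (S k) p 0 (S i) ltac:(lia)).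
      pose proof (lim_nhds_fst (S k) p 0 (S j) ltac:(lia)); pose proof (lim_nhds_snd (S k) p 0 (S j) ltac:(lia)).
      unfold cr, ed; cbn [fst snd]; lims. }
    destruct L as (e & he & L). exists e; split; auto. intros q _ hq.
    apply (L q 0).
    + intros n hn; apply hq; lia.
    + replace (0 - 0) with 0 by ring; now rewrite Rabs_R0.
Qed.

(* Otherwise the sign of the cross product separates the fibre, reflection exchanging the two parts. *)
Lemma nabla_parallel k l x i j : (forall j, (j < k)%nat -> 0 < l j) -> (i < k)%nat -> (j < k)%nat ->
  nabla k l x -> exists z, over l k z x /\ cr (z i) (z j) = 0.
Proof.
  intros hl hi hj [(p0 & hp0 & hx0) hconn].
  pose proof (hl i hi); pose proof (hl j hj).
  apply NNPP; intros K.
  assert (nz : forall p, inC k l p -> theta k p = x -> cr (ed p i) (ed p j) <> 0).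
  { intros p hp hx E. apply K. exists (ev l p); split; [rewrite <- hx; now apply over_ev|].
    transitivity (cr (ed p i) (ed p j) / (l i * l j)); [unfold cr, ev, ed; cbn [fst snd]; field; lra|].
    rewrite E; field; lra. }
  set (mir := fun n => (fst (p0 n), - snd (p0 n)) : point).
  assert (hm : forall a b, Defs.dist (mir a) (mir b) = Defs.dist (p0 a) (p0 b)).
  { intros a b. unfold Defs.dist, mir; cbn [fst snd]. f_equal; ring. }
  assert (cm : cr (ed mir i) (ed mir j) = - cr (ed p0 i) (ed p0 j)).
  { unfold cr, ed, mir; cbn [fst snd]; ring. }
  assert (im : inC k l mir) by (intros n hn; rewrite hm; auto).
  assert (tm : theta k mir = x) by (unfold theta; rewrite hm; exact hx0).
  apply hconn. exists (fun p => 0 < 1 * cr (ed p i) (ed p j)), (fun p => 0 < -1 * cr (ed p i) (ed p j)).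
  split; [now apply openM_cr|]. split; [now apply openM_cr|]. split; [|split; [|split]].
  - intros p hp hx. pose proof (nz p hp hx). destruct (Rlt_or_le 0 (cr (ed p i) (ed p j))); [left|right]; lra.
  - intros p _ _ []; lra.
  - pose proof (nz p0 hp0 hx0). destruct (Rlt_or_le 0 (cr (ed p0 i) (ed p0 j))).
    + exists p0; repeat split; auto; lra.
    + exists mir; repeat split; auto; lra.
  - pose proof (nz p0 hp0 hx0). destruct (Rlt_or_le 0 (cr (ed p0 i) (ed p0 j))).
    + exists mir; repeat split; auto; lra.
    + exists p0; repeat split; auto; lra.
Qed.

Lemma noncritical_pos k l p : inC k l p -> ~ critical_value k l (theta k p) -> 0 < theta k p.
Proof.
  intros hp hc. destruct (dist_ge0 (p O) (p k)) as [h|h]; auto.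
  exfalso; apply hc. exists p; split; auto; split; auto. left; symmetry; exact h.
Qed.

(** If every bar is parallel to the sum, all vertices lie on the line through the origin spanned by
    the sum, and [x] is a critical value. The sum is nonzero because [x] is positive. *)
Lemma noncritical_transverse k l x z : (forall j, (j < k)%nat -> 0 < l j) -> 0 < x ->
  ~ critical_value k l x -> over l k z x -> transverse l k z.
Proof.
  intros hl hx hc oz. apply NNPP; intros K. apply hc. exists (pl l z).
  destruct oz as [hu ho].
  split; [now apply inC_pl|split; [|apply theta_pl; [lra|now split]]].
  right. set (a := sx l k z) in *; set (b := sy l k z) in *.
  exists (- b), a, 0; split.
  - destruct (Req_dec b 0); [right|left]; nra.
  - intros i hi. unfold pl; cbn [fst snd].
    transitivity (sm (fun _ => 0) i); [|clear; induction i; simpl; lra].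
    unfold sx, sy. rewrite <- !sm_scal, <- sm_plus. apply sm_ext; intros j hj.
    assert (cr (a, b) (z j) = 0) as E.
    { apply NNPP; intros N; apply K; exists j; split; auto; lia. }
    unfold cr in E; cbn [fst snd] in E.
    transitivity (l j * (a * snd (z j) - b * fst (z j))); [ring|rewrite E; ring].
Qed.

Lemma contM01_pl k l al X : (forall j, (j < k)%nat -> 0 < l j) ->
  pth l k al 0 1 X -> contM01 k l (fun t => pl l (X t)).
Proof.
  intros hl [cX oX] U [_ hU] t ht hUt.
  assert (inX : forall s, in01 s -> inC k l (pl l (X s))).
  { intros s hs; apply inC_pl; auto. apply (oX s hs). }
  destruct (hU _ (inX t ht) hUt) as (e & he & H).
  assert (K : at_ t (fun s => forall i, (i < S k)%nat ->
     Rabs (sx l i (X s) - sx l i (X t)) < e /\ Rabs (sy l i (X s) - sy l i (X t)) < e)).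
  { apply (filt_forall_lt _ _ (fun i s => Rabs (sx l i (X s) - sx l i (X t)) < e /\
      Rabs (sy l i (X s) - sy l i (X t)) < e)); auto using filt_at.
    intros i hi. apply (proj1 (proj2 (filt_at t))).
    - apply (lim_sx _ (at_ t) X (X t) l i (filt_at t)); auto. intros j hj; apply (cX j ltac:(lia)).
    - apply (lim_sy _ (at_ t) X (X t) l i (filt_at t)); auto. intros j hj; apply (cX j ltac:(lia)). }
  destruct K as (d & hd & K). exists d; split; auto. intros s hs hst.
  apply H; auto. intros i hi. apply K; auto; lia.
Qed.

Theorem mainTheorem7 (k : nat) (l : nat -> R)
  (hk : (2 <= k)%nat)
  (hl : forall i, (i < k)%nat -> 0 < l i)
  (p q : placement) (hp : inC k l p) (hq : inC k l q)
  (hpc : ~ critical_value k l (theta k p))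
  (hqc : ~ critical_value k l (theta k q))
  (alpha : R -> R) (halpha : cont01 alpha)
  (himg : forall t, in01 t -> image_theta k l (alpha t))
  (h0 : alpha 0 = theta k p) (h1 : alpha 1 = theta k q)
  (hnab : exists t, in01 t /\ nabla k l (alpha t)) :
  exists a : R -> placement,
    (forall t, in01 t -> inC k l (a t)) /\
    contM01 k l a /\
    congr k p (a 0) /\ congr k q (a 1) /\
    (forall t, in01 t -> theta k (a t) = alpha t).
Proof.
  destruct (argmax l (fun _ => True) k) as (ia & hia & _ & ma); [exists O; split; auto; lia|].
  destruct (argmax l (fun j => j <> ia) k) as (ib & hib & hba & mb).
  { destruct (Nat.eq_dec ia 0) as [->|n]; [exists 1%nat|exists O]; split; auto; lia. }
  assert (hne : ia <> ib) by auto.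
  assert (hab : l ib <= l ia) by auto.
  assert (hr : forall j, (j < k)%nat -> j <> ia -> j <> ib -> l j <= l ib) by auto.
  (* [alpha] is extended by constants beyond [0,1], as [cont] concerns the whole line. *)
  set (al := fun t => alpha (clamp 0 1 t)).
  assert (ale : forall t, in01 t -> al t = alpha t) by (intros t ht; unfold al; now rewrite clamp_id).
  assert (hal : cont al).
  { intros t e he. destruct (halpha (clamp 0 1 t) ltac:(apply clamp_in; lra) e he) as (d & hd & H).
    destruct (cont_clamp 0 1 t d hd) as (r & hr0 & K). exists r; split; auto.
    intros s hs. apply H; [apply clamp_in; lra|now apply K]. }
  assert (i0 : in01 0) by (unfold in01; lra). assert (i1 : in01 1) by (unfold in01; lra).
  pose proof (over_ev l k p hl hp) as op. rewrite <- h0, <- (ale 0 i0) in op.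
  pose proof (over_ev l k q hl hq) as oq. rewrite <- h1, <- (ale 1 i1) in oq.
  pose proof (noncritical_pos k l p hp hpc) as pp. rewrite <- h0, <- (ale 0 i0) in pp.
  pose proof (noncritical_pos k l q hq hqc) as pq. rewrite <- h1, <- (ale 1 i1) in pq.
  rewrite <- h0, <- (ale 0 i0) in hpc. rewrite <- h1, <- (ale 1 i1) in hqc.
  set (lo := Rmax 0 (2 * l ia - sm l k)). set (T := sm l k).
  assert (hge : forall t, in01 t -> 0 <= al t).
  { intros t ht; rewrite ale by auto. destruct (himg t ht) as (p' & _ & <-). apply dist_ge0. }
  assert (hrange : forall t, 0 <= t <= 1 -> lo <= al t <= T).
  { intros t ht. pose proof (hge t ht) as hg. rewrite ale in * by auto.
    destruct (himg t ht) as (p' & hp' & e). pose proof (over_ev l k p' hl hp') as o. rewrite e in o.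
    assert (hl' : forall j, (j < k)%nat -> 0 <= l j) by (intros; left; auto).
    split; [apply Rmax_lub; auto; now apply (length_ge_excess l k (ev l p'))|
            now apply (length_le_total l k (ev l p'))]. }
  destruct hnab as (t0 & ht0 & hn). rewrite <- ale in hn by auto.
  destruct (nabla_parallel k l (al t0) ia ib hl hia hib hn) as (z & oz & cz).
  destruct (sheet_sections l k ia ib z (al t0) hia hib hne hl hab hr (hge t0 ht0) oz cz) as (B & HB).
  fold T in HB; unfold T in HB; fold lo T in HB.
  assert (sgn : forall r, exists ka, ka ^ 2 = 1 /\ 0 <= ka * r).
  { intros r; destruct (Rle_or_lt 0 r); [exists 1|exists (-1)]; split; try ring; lra. }
  destruct (sgn (cr (ev l p ia) (ev l p ib))) as (kp & hkp & skp).
  destruct (sgn (cr (ev l q ia) (ev l q ib))) as (kq & hkq & skq).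
  destruct (HB kp hkp) as (X & pX & sX & rX), (HB kq hkq) as (Y & pY & sY & rY).
  assert (rXY : rote k (X (al t0)) (Y (al t0))) by (eapply rote_trans; [apply rote_sym; exact rX|exact rY]).
  assert (Sp : forall Z, pth l k (fun y => y) lo T Z -> rote k (X (al 0)) (Z (al 0)) ->
    forall d, 0 < d -> exists t, 0 < t < d /\ lift l k al 0 (ev l p) t (Z (al t))).
  { intros Z pZ rZ. apply (start_lift l k ia ib al (ev l p) hia hib hne hl hab hr hal op pp) with kp lo T X; auto.
    intros z' oz'; now apply noncritical_transverse with (al 0). }
  set (al' := fun t => al (1 - t)).
  assert (hal' : cont al').
  { assert (c0 : cont (fun t => 1 - t)) by (intros t; lims). exact (cont_comp _ _ c0 hal). }
  assert (a0 : al' 0 = al 1) by (unfold al'; f_equal; ring).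
  (* Read backwards, [alpha] starts at [q]; [lift_reverse] turns the resulting lift round. *)
  assert (Sq : forall Z, pth l k (fun y => y) lo T Z -> rote k (Y (al 1)) (Z (al 1)) ->
    forall d, 0 < d -> exists t, 0 < t < d /\ lift l k al (1 - t) (Z (al (1 - t))) 1 (ev l q)).
  { intros Z pZ rZ d hd.
    destruct (start_lift l k ia ib al' (ev l q) hia hib hne hl hab hr hal' ltac:(now rewrite a0)
      ltac:(now rewrite a0)) with kq lo T Y Z d as (t & ht & L); auto.
    - rewrite a0; intros z' oz'; now apply noncritical_transverse with (al 1).
    - intros t ht; unfold al'; apply hrange; lra.
    - now rewrite a0.
    - exists t; split; auto. apply lift_reverse in L. now replace (1 - 0) with 1 in L by ring. }
  assert (along : forall t1 t2 Z, 0 <= t1 -> t1 <= t2 -> t2 <= 1 -> pth l k (fun y => y) lo T Z ->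
    lift l k al t1 (Z (al t1)) t2 (Z (al t2))).
  { intros t1 t2 Z b1 b2 b3 pZ. apply lift_along_section with lo T; auto. intros; apply hrange; lra. }
  (* For [t0] at an end no change of section is possible inside, but a single section that meets [X]
     over [al 0] and [Y] over [al 1] suffices. *)
  assert (one : forall Z, pth l k (fun y => y) lo T Z -> rote k (X (al 0)) (Z (al 0)) ->
    rote k (Y (al 1)) (Z (al 1)) -> lift l k al 0 (ev l p) 1 (ev l q)).
  { intros Z pZ r1 r2. destruct (Sp Z pZ r1 (1/2) ltac:(lra)) as (t1 & b1 & L1).
    destruct (Sq Z pZ r2 (1/2) ltac:(lra)) as (t2 & b2 & L2).
    apply lift_trans with t1 (Z (al t1)); auto; [lra|].
    apply lift_trans with (1 - t2) (Z (al (1 - t2))); auto; [lra|]. apply along; auto; lra. }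
  assert (L : lift l k al 0 (ev l p) 1 (ev l q)).
  (* For 0 < t0 < 1 the lift follows [X] before [t0] and [Y] afterwards. For [t0 = 1] it keeps to
     [X], which meets [Y] over [al 1]; for [t0 = 0] it keeps to [Y]. *)
  { destruct ht0 as [[g0|g0] [g1|g1]].
    - destruct (Sp X pX (rote_refl _ _) t0 g0) as (t1 & b1 & L1).
      destruct (Sq Y pY (rote_refl _ _) (1 - t0) ltac:(lra)) as (t2 & b2 & L2).
      apply lift_trans with t1 (X (al t1)); auto; [lra|].
      apply lift_trans with t0 (Y (al t0)); auto; [lra| |].
      + eapply lift_rote; [apply rote_refl|apply rote_sym; exact rXY|]. apply along; auto; lra.
      + apply lift_trans with (1 - t2) (Y (al (1 - t2))); auto; [lra|]. apply along; auto; lra.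
    - subst t0. apply (one X); auto using rote_refl, rote_sym.
    - subst t0. apply (one Y); auto using rote_refl.
    - lra. }
  destruct L as (Z & pZ & r0 & r1).
  exists (fun t => pl l (Z t)); split; [|split; [|split; [|split]]].
  - intros t ht; apply inC_pl; auto. apply (proj2 pZ t ht).
  - now apply contM01_pl with al.
  - now apply congr_pl.
  - now apply congr_pl.
  - intros t ht. rewrite <- ale by auto. apply theta_pl; auto. apply (proj2 pZ t ht).
Qed.
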